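(* Let $\Sigma$ be a (bounded) smooth $2$-manifold without boundary embedded in $\mathbb{R}^3$. Let $\tau$ be a triangle whose vertices lie on $\Sigma$. Let $R$ be the circumradius of $\tau$. Let $v$ be a vertex of $\tau$ and let $\phi$ be the plane angle of $\tau$ at $v$. Then, whenever the argument of the arcsine is at most $1$, $$\angle(N_\tau, N_v\Sigma) = \angle(\mathrm{aff}\,\tau, T_v\Sigma) \leq \arcsin\left( \frac{R}{\mathrm{ebs}(v)} \max\left\{ \cot\frac{\phi}{2}, 1 \right\} \right).$$ In particular, if $v$ is the vertex at the largest plane angle of $\tau$ (so $\phi \geq 60^\circ$) and $R < \mathrm{ebs}(v)/\sqrt{3}$, then $$\angle(N_\tau, N_v\Sigma) = \angle(\mathrm{aff}\,\tau, T_v\Sigma) \leq \arcsin\frac{\sqrt{3}\,R}{\mathrm{ebs}(v)}.$$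
   Context: A bounded smooth manifold without boundary in $\mathbb{R}^d$ means a compact smoothly embedded submanifold without boundary. For $p \in \Sigma$, $T_p\Sigma$ is the tangent plane at $p$ (a flat through $p$) and $N_p\Sigma$ is the line through $p$ orthogonal to $T_p\Sigma$. The medial axis $M$ of $\Sigma$ is the closure of the set of points of $\mathbb{R}^3$ having more than one nearest point on $\Sigma$. The empty ball size is $\mathrm{ebs}(p) = \min_{m \in M \cap N_p\Sigma} |pm|$, equivalently the radius of the smallest medial ball tangent to $\Sigma$ at $p$ (a medial ball is an open ball centered on $M$, disjoint from $\Sigma$, whose boundary intersects $\Sigma$). For a triangle $\tau$, $\mathrm{aff}\,\tau$ is its affine hull and $N_\tau$ is the flat of points equidistant to the three vertices of $\tau$ (orthogonal to $\mathrm{aff}\,\tau$). The circumradius is the radius of the circle through the three vertices; the plane angle at $v$ is the usual interior angle of the triangle at $v$. For flats $F, G$ with $\dim F \le \dim G$, $\angle(F,G) = \angle(G,F) = \max_{\ell_F \subset F}\min_{\ell_G \subset G} \angle(\ell_F,\ell_G) \in [0^\circ, 90^\circ]$, where $\ell_F,\ell_G$ range over lines and $\angle(\ell_F,\ell_G)$ is the nonobtuse angle between their directions. *)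

(* Defs.v *)
(* MathComp / MathComp-Analysis. *)
From HB Require Import structures.
From mathcomp Require Import all_boot all_order all_algebra.
From mathcomp Require Import all_classical all_reals all_analysis.
Set Implicit Arguments.
Unset Strict Implicit.
Unset Printing Implicit Defensive.
Import Order.TTheory GRing.Theory Num.Theory.
Import numFieldNormedType.Exports.
Local Open Scope classical_set_scope.
Local Open Scope ring_scope.

(* The library norm `|x| on row vectors is the max norm. It is used only for
   its topology (open, closure, compact, continuous, derivatives), which is the
   Euclidean one; distances and angles are computed from [dotv]. *)
Definition dotv {R : realType} {n : nat} (x y : 'rV[R]_n) : R :=
  \sum_(i < n) x 0 i * y 0 i.

Definition enorm {R : realType} {n : nat} (x : 'rV[R]_n) : R :=
  Num.sqrt (dotv x x).

Definition edist {R : realType} {n : nat} (x y : 'rV[R]_n) : R :=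
  enorm (x - y).

(* Meant for open [U]. *)
Fixpoint Ck_on {R : realType} {V W : normedModType R} (k : nat) (U : set V)
    (f : V -> W) : Prop :=
  match k with
  | 0%N => forall x, U x -> {for x, continuous f}
  | k'.+1 => (forall x, U x -> differentiable f x) /\
             (forall u : V, Ck_on k' U (fun x => 'D_u f x))
  end.

Definition smooth_on {R : realType} {V W : normedModType R} (U : set V)
    (f : V -> W) : Prop := forall k : nat, Ck_on k U f.

(* [psi] restricted to [U] is a smooth regular parametrization of [S `&` V]:
   an immersion that is a homeomorphism from [U] onto [S `&` V], with continuous
   inverse [chi]. *)
Definition local_param {R : realType} (S V : set 'rV[R]_3) (U : set 'rV[R]_2)
    (psi : 'rV[R]_2 -> 'rV[R]_3) : Prop :=
  [/\ smooth_on U psi,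
      forall u, U u -> injective ('d psi u),
      psi @` U = S `&` V &
      exists chi : 'rV[R]_3 -> 'rV[R]_2,
        {within S `&` V, continuous chi} /\
        (forall u, U u -> chi (psi u) = u)].

(* A smoothly embedded 2-manifold without boundary; connectedness is not
   required. *)
Definition smooth_surface {R : realType} (S : set 'rV[R]_3) : Prop :=
  forall p, S p ->
    exists (V : set 'rV[R]_3) (U : set 'rV[R]_2) (psi : 'rV[R]_2 -> 'rV[R]_3),
      [/\ open V, V p, open U & local_param S V U psi].

Definition tangent_vector {R : realType} (S : set 'rV[R]_3) (p w : 'rV[R]_3)
    : Prop :=
  exists (J : set R) (c : R -> 'rV[R]_3),
    [/\ open J /\ J 0, smooth_on J c, (forall t, J t -> S (c t)),
        c 0 = p & derive1 c 0 = w].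

Definition tangent_plane {R : realType} (S : set 'rV[R]_3) (p : 'rV[R]_3)
    : set 'rV[R]_3 := [set q | tangent_vector S p (q - p)].

Definition normal_line {R : realType} (S : set 'rV[R]_3) (p : 'rV[R]_3)
    : set 'rV[R]_3 :=
  [set q | forall x, tangent_plane S p x -> dotv (q - p) (x - p) = 0].

Definition nearest {R : realType} (S : set 'rV[R]_3) (x p : 'rV[R]_3) : Prop :=
  S p /\ forall q, S q -> edist x p <= edist x q.

Definition medial_axis {R : realType} (S : set 'rV[R]_3) : set 'rV[R]_3 :=
  closure [set x | exists p q, [/\ p <> q, nearest S x p & nearest S x q]].

(* The minimum of a closed set of distances, written as an infimum. [inf] has
   the default value 0 on the empty set. *)
Definition ebs {R : realType} (S : set 'rV[R]_3) (p : 'rV[R]_3) : R :=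
  inf [set edist p m | m in medial_axis S `&` normal_line S p].

Definition triangle {R : realType} (a b c : 'rV[R]_3) : Prop :=
  free [:: b - a; c - a].

Definition aff_tri {R : realType} (a b c : 'rV[R]_3) : set 'rV[R]_3 :=
  [set x | exists s t u : R, s + t + u = 1 /\ x = s *: a + t *: b + u *: c].

Definition equidistant {R : realType} (a b c : 'rV[R]_3) : set 'rV[R]_3 :=
  [set x | edist x a = edist x b /\ edist x b = edist x c].

(* For a triangle, [aff_tri a b c `&` equidistant a b c] is a singleton, the
   center of the circle through [a], [b], [c]; [xget] picks its element. *)
Definition circumcenter {R : realType} (a b c : 'rV[R]_3) : 'rV[R]_3 :=
  xget a (aff_tri a b c `&` equidistant a b c).

Definition circumradius {R : realType} (a b c : 'rV[R]_3) : R :=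
  edist (circumcenter a b c) a.

(* The angle at the first argument. *)
Definition plane_angle {R : realType} (a b c : 'rV[R]_3) : R :=
  acos (dotv (b - a) (c - a) / (enorm (b - a) * enorm (c - a))).

Definition cot {R : realType} (x : R) : R := cos x / sin x.

Definition line_dir {R : realType} (F : set 'rV[R]_3) : set 'rV[R]_3 :=
  [set u | u != 0 /\ exists p, forall t : R, F (p + t *: u)].

(* The nonobtuse angle between lines with direction vectors [u] and [w]. *)
Definition line_angle {R : realType} (u w : 'rV[R]_3) : R :=
  acos (`|dotv u w| / (enorm u * enorm w)).

(* The angle between flats, for dim F <= dim G: the max over lines in F of the
   min over lines in G, written with [sup] and [inf]; both are attained. A line
   enters through any of its direction vectors. *)
Definition flat_angle {R : realType} (F G : set 'rV[R]_3) : R :=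
  sup [set inf [set line_angle u w | w in line_dir G] | u in line_dir F].

(* Main.v *)
(* Let N be a normal vector of S at v. A point p of S off the tangent plane
   at v bounds the balls tangent to S at v, on the side of p, that contain no
   point of S. If c is the center of the largest such ball, then c lies on the
   medial axis: otherwise all points near c have a unique nearest point, hence
   the distance to S can be increased at unit speed from c, which forces v to stay
   nearest further out on the normal line. This needs no differentiability of S;
   smoothness is used only near v, where a second-order Taylor bound gives a
   tangent ball of positive radius and keeps the medial axis away from v. Hence
   2 ebs(v) |N.(p - v)| <= |N| |p - v|^2 for every p in S.

   Put A = a - v and B = b - v. For a unit normal N the squared sine of the angle
   between the planes is the squared norm of the projection g of N to span(A, B),
   and |g.A| <= |A|^2 / (2 ebs), |g.B| <= |B|^2 / (2 ebs) bound it by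
   (R / ebs)^2 (|A|^2 + |B|^2 + 2 |A.B|) / (|A|^2 + |B|^2 - 2 A.B). *)
Require Import Defs.
From HB Require Import structures.
From mathcomp Require Import all_boot all_order all_algebra.
From mathcomp Require Import all_classical all_reals all_analysis.
From mathcomp Require Import ring lra.
Set Implicit Arguments.
Unset Strict Implicit.
Unset Printing Implicit Defensive.
Import Order.TTheory GRing.Theory Num.Theory.
Import numFieldNormedType.Exports.
Local Open Scope classical_set_scope.
Local Open Scope ring_scope.

(* mathcomp-analysis has an [edist] of its own, which would shadow that of Defs. *)
Local Notation edist := Defs.edist.

(** The largest empty tangent ball may touch [S] at [v] alone, as at a center of curvature, so its
    center need not have two nearest points. Hence the argument cannot look for a second contact
    point. It supposes the center off the medial axis, which, being closed, leaves a whole ball of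
    points with unique nearest points. The nearest point may change along any path that increases
    the distance, so no such path is followed: a maximizer over a small ball replaces it. Both flat
    angles are the angle between the normals A x B and N, so a single sine is estimated. R enters
    through |A| |B| |A - B| = 4 R area, the Gram determinant of A and B being 4 area^2. The quotient
    that ends the overview equals 1 if A.B <= 0; otherwise |A|^2 + |B|^2 >= 2 |A| |B| bounds it by
    (1 + cos phi) / (1 - cos phi) = cot^2(phi / 2). Hence the maximum with 1, and sqrt 3 = cot 30
    degrees once phi >= 60 degrees. *)

Section Dot.
Variables (R : realType) (n : nat).
Implicit Types (x y z : 'rV[R]_n) (k : R).

(** * Euclidean inner product, norm and distance *)

Lemma dotvC x y : dotv x y = dotv y x.
Proof. by apply: eq_bigr => i _; rewrite mulrC. Qed.

Lemma dotvDl x y z : dotv (x + y) z = dotv x z + dotv y z.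
Proof. by rewrite -big_split; apply: eq_bigr => i _; rewrite mxE mulrDl. Qed.

Lemma dotvZl k x z : dotv (k *: x) z = k * dotv x z.
Proof. by rewrite /dotv mulr_sumr; apply: eq_bigr => i _; rewrite mxE mulrA. Qed.

Lemma dotvNl x z : dotv (- x) z = - dotv x z.
Proof. by rewrite -scaleN1r dotvZl mulN1r. Qed.

Lemma dotvDr x y z : dotv z (x + y) = dotv z x + dotv z y.
Proof. by rewrite dotvC dotvDl !(dotvC z). Qed.

Lemma dotvZr k x z : dotv z (k *: x) = k * dotv z x.
Proof. by rewrite dotvC dotvZl dotvC. Qed.

Lemma dotvNr x z : dotv z (- x) = - dotv z x.
Proof. by rewrite dotvC dotvNl dotvC. Qed.

Lemma dot0v x : dotv 0 x = 0.
Proof. by rewrite -(scale0r 0) dotvZl mul0r. Qed.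

Lemma dotv0 x : dotv x 0 = 0.
Proof. by rewrite dotvC dot0v. Qed.

Definition dotvE := (dotvDl, dotvDr, dotvNl, dotvNr, dotvZl, dotvZr, dot0v, dotv0).

Lemma dotv_ge0 x : 0 <= dotv x x.
Proof. by apply: sumr_ge0 => i _; rewrite -expr2 sqr_ge0. Qed.

Lemma sqr_coord_le_dotv x (i : 'I_n) : x 0 i ^+ 2 <= dotv x x.
Proof.
rewrite /dotv (bigD1 i) //= -expr2 lerDl.
by apply: sumr_ge0 => j _; rewrite -expr2 sqr_ge0.
Qed.

Lemma dotv_eq0 x : (dotv x x == 0) = (x == 0).
Proof.
apply/eqP/eqP => [x0|->]; last exact: dot0v.
apply/rowP => i; rewrite mxE; apply/eqP; rewrite -sqrf_eq0 eq_le sqr_ge0 andbT.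
by rewrite -x0 sqr_coord_le_dotv.
Qed.

Lemma dotv_gt0 x : (0 < dotv x x) = (x != 0).
Proof. by rewrite lt_def dotv_eq0 dotv_ge0 andbT. Qed.

Lemma enorm_ge0 x : 0 <= enorm x.
Proof. exact: sqrtr_ge0. Qed.

Lemma enorm_sqr x : enorm x ^+ 2 = dotv x x.
Proof. by rewrite sqr_sqrtr // dotv_ge0. Qed.

Lemma enorm_gt0 x : (0 < enorm x) = (x != 0).
Proof. by rewrite sqrtr_gt0 dotv_gt0. Qed.

Lemma enorm_eq0 x : (enorm x == 0) = (x == 0).
Proof. by rewrite eq_le enorm_ge0 andbT leNgt enorm_gt0 negbK. Qed.

Lemma enorm0 : enorm (0 : 'rV[R]_n) = 0.
Proof. by apply/eqP; rewrite enorm_eq0. Qed.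

Lemma enormN x : enorm (- x) = enorm x.
Proof. by rewrite /enorm !dotvE opprK. Qed.

Lemma enormZ k x : enorm (k *: x) = `|k| * enorm x.
Proof.
by rewrite /enorm dotvZl dotvZr mulrA -expr2 sqrtrM ?sqr_ge0// sqrtr_sqr.
Qed.

Lemma enorm_le_sqr x y : (enorm x <= enorm y) = (dotv x x <= dotv y y).
Proof. by rewrite ler_sqrt ?dotv_ge0. Qed.

Lemma dotv_sqrD x y : dotv (x + y) (x + y) = dotv x x + 2 * dotv x y + dotv y y.
Proof. by rewrite !dotvE (dotvC y x); ring. Qed.

Lemma CauchySchwarz_dotv x y : dotv x y ^+ 2 <= dotv x x * dotv y y.
Proof.
have [->|y0] := eqVneq y 0; first by rewrite !dotvE expr0n mulr0.
have yy : 0 < dotv y y by rewrite dotv_gt0.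
have := dotv_ge0 (dotv y y *: x - dotv x y *: y).
have -> : dotv (dotv y y *: x - dotv x y *: y) (dotv y y *: x - dotv x y *: y) =
    dotv y y * (dotv x x * dotv y y - dotv x y ^+ 2).
  by rewrite !dotvE (dotvC y x); ring.
by rewrite pmulr_rge0 // subr_ge0.
Qed.

Lemma normr_dotv_le x y : `|dotv x y| <= enorm x * enorm y.
Proof.
rewrite -(@ler_pXn2r _ 2) ?nnegrE ?mulr_ge0 ?enorm_ge0//.
by rewrite exprMn !enorm_sqr real_normK ?num_real// CauchySchwarz_dotv.
Qed.

Lemma dotv_le x y : dotv x y <= enorm x * enorm y.
Proof. exact: le_trans (ler_norm _) (normr_dotv_le x y). Qed.

Lemma enorm_triangle x y : enorm (x + y) <= enorm x + enorm y.
Proof.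
rewrite -(@ler_pXn2r _ 2) ?nnegrE ?addr_ge0 ?enorm_ge0//.
rewrite sqrrD !enorm_sqr dotv_sqrD.
have := dotv_le x y; lra.
Qed.

Lemma edist_ge0 x y : 0 <= edist x y.
Proof. exact: enorm_ge0. Qed.

Lemma edistC x y : edist x y = edist y x.
Proof. by rewrite /edist -enormN opprB. Qed.

Lemma edist_triangle z x y : edist x y <= edist x z + edist z y.
Proof.
have -> : edist x y = enorm ((x - z) + (z - y)) by rewrite addrA subrK.
exact: enorm_triangle.
Qed.

Lemma edist_eq0 x y : (edist x y == 0) = (x == y).
Proof. by rewrite enorm_eq0 subr_eq0. Qed.

Lemma edistxx x : edist x x = 0.
Proof. by rewrite /edist subrr enorm0. Qed.

Lemma normr_coord_le_enorm x (i : 'I_n) : `|x 0 i| <= enorm x.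
Proof.
rewrite -(@ler_pXn2r _ 2) ?nnegrE ?enorm_ge0//.
by rewrite enorm_sqr real_normK ?num_real// sqr_coord_le_dotv.
Qed.

Lemma enorm_le_sum x : enorm x <= \sum_(i < n) `|x 0 i|.
Proof.
rewrite -(@ler_pXn2r _ 2) ?nnegrE ?enorm_ge0// ?sumr_ge0//.
rewrite enorm_sqr expr2 mulr_suml; apply: ler_sum => i _.
rewrite (le_trans (ler_norm _))// normrM ler_wpM2l// (bigD1 i)//= lerDl.
exact: sumr_ge0.
Qed.

(** The library topology comes from the max norm; limits, closures and neighborhoods pass to
    Euclidean balls through this equivalence. *)
Lemma nbhs_edistP x (A : set 'rV[R]_n) :
  nbhs x A <-> exists2 e, 0 < e & forall y, edist y x < e -> A y.
Proof.
split=> [/nbhs_ballP[e /= e0 xeA]|[e e0 xA]].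
  exists e => // y yx; apply: xeA; split=> // i j; rewrite ord1.
  rewrite /ball/= distrC; apply: le_lt_trans yx.
  by have := normr_coord_le_enorm (y - x) j; rewrite !mxE.
(* The denominator [n.+1] keeps a sum of [n] terms strictly below [e] and covers [n = 0]. *)
apply/nbhs_ballP; exists (e / n.+1%:R) => /=; first by rewrite divr_gt0.
move=> y [_ xy]; apply: xA; apply: le_lt_trans (enorm_le_sum _) _.
apply: (@le_lt_trans _ _ (\sum_(i < n) e / n.+1%:R)).
  apply: ler_sum => i _; rewrite !mxE distrC ltW//; exact: (xy 0 i).
rewrite sumr_const card_ord -[X in X < _]mulr_natl mulrCA gtr_pMr//.
by rewrite ltr_pdivrMr// mul1r ltr_nat.
Qed.

Lemma lipschitz_continuous (f : 'rV[R]_n -> R) (k : R) :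
  (forall x y, `|f x - f y| <= k * edist x y) -> continuous f.
Proof.
move=> fk x; apply/(@cvgrPdist_lt _ _ _ (nbhs x)) => e e0; apply/nbhs_edistP.
have k0 : 0 < `|k| + 1 by rewrite ltr_wpDl.
exists (e / (`|k| + 1)); first by rewrite divr_gt0.
move=> y; rewrite ltr_pdivlMr// => ye; apply: le_lt_trans (fk _ _) _.
apply: le_lt_trans ye; rewrite edistC mulrC ler_wpM2l ?edist_ge0//.
by rewrite (le_trans (ler_norm _))// lerDl.
Qed.

Lemma edist_continuous x : continuous (fun y : 'rV[R]_n => edist y x).
Proof.
apply: (@lipschitz_continuous _ 1) => y z; rewrite mul1r ler_norml.
rewrite lerBlDr edist_triangle andbT lerBrDr addrC lerBlDr [edist y z]edistC.
by rewrite addrC edist_triangle.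
Qed.

Lemma edist_compact (A : set 'rV[R]_n) c (r : R) : closed A ->
  (forall y, A y -> edist y c <= r) -> compact A.
Proof.
move=> clA Ar; apply: bounded_closed_compact => //.
exists (r + enorm c); split; first exact: num_real.
move=> M rM y /Ar yc; rewrite /= /Num.norm /= mx_normrE.
have M0 : enorm y <= M.
  apply: le_trans (ltW rM); rewrite -[y in enorm y](subrK c).
  by rewrite (le_trans (enorm_triangle _ _)) ?lerD2r.
apply/bigmax_leP; split; first exact: le_trans (enorm_ge0 _) M0.
by move=> [i j] _ /=; rewrite ord1 (le_trans (normr_coord_le_enorm _ _)).
Qed.

Lemma closed_edist_ball c (r : R) : closed [set y : 'rV[R]_n | edist y c <= r].
Proof.
have := @closed_comp _ _ (fun y : 'rV[R]_n => edist y c) [set x | x <= r].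
by apply; [move=> x _; exact: edist_continuous|exact: closed_le].
Qed.

Lemma dotv_continuous x : continuous (fun y : 'rV[R]_n => dotv x y).
Proof.
apply: (@lipschitz_continuous _ (enorm x)) => y z.
by rewrite -dotvNr -dotvDr normr_dotv_le.
Qed.

End Dot.

(** * Cross product and Gram determinant *)

Section Cross.
Variable R : realType.
Implicit Types x y z : 'rV[R]_3.

Let i0 : 'I_3 := @Ordinal 3 0 isT.
Let i1 : 'I_3 := @Ordinal 3 1 isT.
Let i2 : 'I_3 := @Ordinal 3 2 isT.

Definition cross x y : 'rV[R]_3 := \row_i
  [:: x 0 i1 * y 0 i2 - x 0 i2 * y 0 i1;
      x 0 i2 * y 0 i0 - x 0 i0 * y 0 i2;
      x 0 i0 * y 0 i1 - x 0 i1 * y 0 i0]`_i.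

Let dotv3 x y : dotv x y = x 0 i0 * y 0 i0 + x 0 i1 * y 0 i1 + x 0 i2 * y 0 i2.
Proof.
rewrite /dotv !big_ord_recl big_ord0 addr0 !addrA.
by congr (_ * _ + _ * _ + _ * _); congr (_ _ _); apply: val_inj.
Qed.

Let row3P x y : x 0 i0 = y 0 i0 -> x 0 i1 = y 0 i1 -> x 0 i2 = y 0 i2 -> x = y.
Proof.
move=> h0 h1 h2; apply/rowP => -[[|[|[|//]]] i].
- by rewrite (_ : Ordinal i = i0)//; apply: val_inj.
- by rewrite (_ : Ordinal i = i1)//; apply: val_inj.
- by rewrite (_ : Ordinal i = i2)//; apply: val_inj.
Qed.

Lemma dotv_crossl x y : dotv (cross x y) x = 0.
Proof. by rewrite dotv3 !mxE /=; ring. Qed.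

Lemma dotv_crossr x y : dotv (cross x y) y = 0.
Proof. by rewrite dotv3 !mxE /=; ring. Qed.

Lemma dotv_cross_comb x y (k l : R) : dotv (cross x y) (k *: x + l *: y) = 0.
Proof. by rewrite dotvDr !dotvZr dotv_crossl dotv_crossr !mulr0 addr0. Qed.

Lemma dotv_cross x y :
  dotv (cross x y) (cross x y) = dotv x x * dotv y y - dotv x y ^+ 2.
Proof. by rewrite !dotv3 !mxE /=; ring. Qed.

(** Expansion of [z] in the frame [x], [y], [cross x y], the inverse Gram matrix giving the
    coefficients in the plane. It is multiplied through by the Gram determinant, hence a polynomial
    identity. *)
Lemma cross_decomp x y z : dotv (cross x y) (cross x y) *: z =
  dotv z (cross x y) *: cross x y
  + (dotv y y * dotv z x - dotv x y * dotv z y) *: x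
  + (dotv x x * dotv z y - dotv x y * dotv z x) *: y.
Proof. by apply: row3P; rewrite !dotv3 !mxE /=; ring. Qed.

(* The parenthesis is the Gram determinant of [x] and [y] times the squared norm
   of the projection of [z] to their span. *)
Lemma cross_pythagoras x y z : dotv (cross x y) (cross x y) * dotv z z =
  dotv z (cross x y) ^+ 2 + (dotv y y * dotv z x ^+ 2
   - 2 * dotv x y * dotv z x * dotv z y + dotv x x * dotv z y ^+ 2).
Proof.
rewrite -dotvZl cross_decomp !dotvDl !dotvZl.
by rewrite (dotvC _ z) (dotvC x z) (dotvC y z); ring.
Qed.

(** Equality case of Cauchy-Schwarz: a vanishing Gram determinant kills the residual of the
    projection of [x] to [y]. *)
Lemma cross_eq0 x y : cross x y = 0 -> y != 0 ->
  x = (dotv x y / dotv y y) *: y.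
Proof.
move=> xy0; rewrite -dotv_eq0 => yy.
apply/eqP; rewrite -subr_eq0 -dotv_eq0 dotv_sqrD !dotvE.
have := dotv_cross x y; rewrite xy0 dotv0 => /esym/eqP; rewrite subr_eq0 => /eqP E.
apply/eqP; rewrite -[RHS](mul0r (dotv y y)^-1) -(subrr (dotv x y ^+ 2)) -{1}E.
by field.
Qed.

Lemma cross_neq0 x y : cross x y != 0 -> x != 0 /\ y != 0.
Proof.
move=> xy0; split; apply: contraNneq xy0 => ->; rewrite -dotv_eq0 dotv_cross.
  by rewrite !dot0v mul0r expr0n subr0.
by rewrite !dotv0 mulr0 expr0n subr0.
Qed.

Lemma free_cross_neq0 x y : free [:: x; y] -> cross x y != 0.
Proof.
rewrite free_cons seq1_free span_seq1 => /andP[xy y0].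
apply: contra xy => /eqP /cross_eq0 /(_ y0) ->.
by rewrite memvZ ?memv_line.
Qed.

End Cross.

(** * Nearest points, growth of the distance, and medial points on a ray *)

Section Nearest.
Variable R : realType.

Lemma edist_sqr n (x y : 'rV[R]_n) : edist x y ^+ 2 = dotv (x - y) (x - y).
Proof. exact: enorm_sqr. Qed.

Lemma compact_edist_min n (A : set 'rV[R]_n) x : compact A -> A !=set0 ->
  exists2 p, A p & forall q, A q -> edist x p <= edist x q.
Proof.
move=> cA A0.
have [|p /set_mem Ap pmin] := @EVT_max_rV _ _ (fun y => - edist y x) A A0 cA.
  apply: continuous_subspaceT => y; have h := @edist_continuous _ _ x y.
  exact: (cvgN h).
exists p => // q /mem_set /pmin; rewrite lerN2.
by rewrite ![edist x _]edistC.
Qed.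

Lemma nearest_exists n (S : set 'rV[R]_n) x : compact S -> S !=set0 ->
  exists p, S p /\ forall q, S q -> edist x p <= edist x q.
Proof. by move=> cS S0; have [p Sp pP] := compact_edist_min x cS S0; exists p. Qed.

(* Points of [S] seen from [y] at a definite angle to [p] are farther than [p] by
   a fixed gap (compactness), so for short moves only points near [p] compete. *)
Lemma unique_nearest_ascent n (S : set 'rV[R]_n) (y p : 'rV[R]_n) (lam : R) :
  compact S -> S p -> 0 < edist y p ->
  (forall q, S q -> q != p -> edist y p < edist y q) ->
  0 < lam < 1 ->
  exists2 eta, 0 < eta & forall del, 0 < del < eta -> forall q, S q ->
    edist y p + lam * del <=
    edist (y + (del / edist y p) *: (y - p)) q.
Proof.
move=> cS Sp d0 uniqp /andP[l0 l1].
set d := edist y p in d0 *.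
pose K := S `&` [set q | dotv (y - p) (y - q) <= lam * d ^+ 2].
have clK : closed [set q | dotv (y - p) (y - q) <= lam * d ^+ 2].
  have -> : [set q | dotv (y - p) (y - q) <= lam * d ^+ 2] =
      (fun q => dotv (y - p) q) @^-1` [set x | dotv (y - p) y - lam * d ^+ 2 <= x].
    apply/seteqP; split => q /=; rewrite dotvDr dotvNr; lra.
  apply: closed_comp; last exact: closed_ge.
  by move=> q _; exact: dotv_continuous.
have cK : compact K by exact: compact_closedI.
(* Outside [K] the square of the new distance is at least [d^2 + 2 lam d del + del^2], which exceeds
   [(d + lam del)^2] because [lam < 1]; this holds for every [del > 0]. *)
have far q del : 0 < del -> S q -> ~ K q -> d + lam * del <=
    edist (y + (del / d) *: (y - p)) q.
  move=> del0 Sq Kq.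
  have {}Kq : lam * d ^+ 2 < dotv (y - p) (y - q).
    by rewrite ltNge; apply/negP => ?; apply: Kq.
  have dyq : d ^+ 2 <= dotv (y - q) (y - q).
    rewrite -edist_sqr lerXn2r ?nnegrE ?edist_ge0//.
    by have [->//|/(uniqp _ Sq)/ltW] := eqVneq q p.
  rewrite -(@ler_pXn2r _ 2) ?nnegrE ?edist_ge0//; last first.
    by rewrite addr_ge0// ?mulr_ge0// ltW.
  rewrite edist_sqr (_ : y + _ - q = (y - q) + (del / d) *: (y - p)); last first.
    by rewrite addrAC.
  rewrite dotv_sqrD !dotvZl !dotvZr -(edist_sqr y p) (dotvC (y - q) (y - p)) -/d.
  move: (dotv (y - q) (y - q)) (dotv (y - p) (y - q)) Kq dyq => A B Kq dyq.
  have -> : A + 2 * (del / d * B) + del / d * (del / d * d ^+ 2) =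
     A + 2 * del * (B / d) + del ^+ 2 by field; rewrite gt_eqF.
  have : lam * d <= B / d by rewrite ler_pdivlMr// -mulrA -expr2 ltW.
  move: (B / d) => C lC.
  have h1 : 0 <= del * (C - lam * d) by rewrite mulr_ge0 ?subr_ge0// ltW.
  have h2 : 0 <= del ^+ 2 * ((1 - lam) * (1 + lam)).
    by rewrite mulr_ge0 ?sqr_ge0// mulr_ge0//; lra.
  nra.
have [[q0 Kq0]|K0] := pselect (K !=set0); last first.
  exists 1 => // del /andP[del0 _] q Sq; apply: far => // Kq.
  by apply: K0; exists q.
have [q1 [Sq1 /= Kq1] q1min] := @compact_edist_min _ K y cK (ex_intro _ q0 Kq0).
have q1p : q1 != p.
  apply/eqP => q1p; move: Kq1; rewrite q1p -edist_sqr -/d leNgt gtr_pMl ?l1//.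
  by rewrite exprn_gt0.
(* Half the gap: a move of length [del] brings [q] closer by at most [del], and the growth claimed
   is also at most [del]. *)
exists ((edist y q1 - d) / 2) => [|del /andP[del0 delg] q Sq].
  by rewrite divr_gt0// subr_gt0 uniqp.
have [Kq|Kq] := pselect (K q); last exact: far.
have yq := q1min _ Kq.
have y'y : edist (y + (del / d) *: (y - p)) y = del.
  rewrite /Defs.edist addrAC subrr add0r enormZ -/(Defs.edist y p) -/d.
  by rewrite ger0_norm ?divfK ?gt_eqF// divr_ge0// ltW.
have := edist_triangle (y + (del / d) *: (y - p)) y q.
rewrite [edist y (_ + _)]edistC y'y; have : lam * del <= del by rewrite ger_pMl// ltW.
lra.
Qed.

(* A maximizer over the ball of [d - lam * edist ^~ c], with [d] the distance to
   [S], lies on the boundary by [unique_nearest_ascent]; then [lam] tends to 1. *)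
Lemma nearest_push n (S : set 'rV[R]_n) (v c : 'rV[R]_n) (tau : R) :
  compact S -> S v -> (forall q, S q -> edist c v <= edist c q) ->
  0 < tau < edist c v ->
  (forall y p q, edist y c <= tau -> S p -> S q ->
    (forall r, S r -> edist y p <= edist y r) ->
    (forall r, S r -> edist y q <= edist y r) -> p = q) ->
  exists2 y, edist y c <= tau & forall q, S q -> edist c v + tau <= edist y q.
Proof.
move=> cS Sv vmin /andP[tau0 tau_lt] uniq.
have /boolp.choice[proj projP] : forall y, exists p, S p /\
    forall q, S q -> edist y p <= edist y q.
  by move=> y; apply: nearest_exists => //; exists v.
pose d y := edist y (proj y).
have dmin y q : S q -> d y <= edist y q by move=> Sq; exact: (projP y).2.
have dle x y : d x <= d y + edist x y.
  apply: le_trans (dmin x _ (projP y).1) _.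
  by rewrite addrC; exact: edist_triangle.
have dcont : continuous d.
  apply: (@lipschitz_continuous _ _ _ 1) => x y; rewrite mul1r ler_norml.
  have := dle x y; have := dle y x; rewrite (edistC y x) => ? ?.
  by apply/andP; split; lra.
have dc : d c = edist c v.
  by apply/le_anti/andP; split; [exact: dmin|exact: vmin (projP c).1].
pose B := [set y : 'rV[R]_n | edist y c <= tau].
have cB : compact B.
  by apply: (@edist_compact _ _ _ c tau) => //; exact: closed_edist_ball.
have Bc : B c by rewrite /B /= edistxx ltW.
have reach lam : 0 < lam < 1 -> exists2 y, B y & d c + lam * tau <= d y.
  move=> /andP[l0 l1].
  have [|y /set_mem By ymax] := @EVT_max_rV _ _ (fun y => d y - lam * edist y c) B
      (ex_intro _ c Bc) cB.
    apply: continuous_subspaceT => y.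
    have h := @edist_continuous _ _ c y.
    exact: (cvgB (dcont y) (cvgM (cvg_cst lam) h)).
  have := ymax c (mem_set Bc); rewrite edistxx mulr0 subr0 => ycy.
  have lamy : 0 <= lam * edist y c by rewrite mulr_ge0 ?edist_ge0// ltW.
  exists y => //; suff -> : tau = edist y c by lra.
  apply/eqP; rewrite eq_le [X in _ && X]By andbT leNgt; apply/negP => yin.
  have dy0 : 0 < edist y (proj y) by rewrite -/(d y); rewrite dc in ycy; lra.
  have uy q : S q -> q != proj y -> edist y (proj y) < edist y q.
    move=> Sq qp; rewrite ltNge; apply/negP => qy; move/eqP: qp; apply.
    apply: (uniq y) => //; first exact: (projP y).1.
      by move=> r Sr; apply: le_trans qy _; exact: dmin.
    by move=> r Sr; exact: dmin.
  (* Any growth rate strictly between [lam] and 1 beats the penalty [lam * edist y c], contradicting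
     maximality at an interior point; the midpoint is taken. *)
  have l1' : 0 < (1 + lam) / 2 < 1 by apply/andP; split; lra.
  have [eta eta0 etaP] := unique_nearest_ascent cS (projP y).1 dy0 uy l1'.
  pose del := Num.min (eta / 2) (tau - edist y c).
  have del0 : 0 < del by rewrite lt_min; apply/andP; split; lra.
  have deleta : del < eta by rewrite gt_min; apply/orP; left; lra.
  have delt : del <= tau - edist y c by rewrite ge_min lexx orbT.
  set y' := y + (del / edist y (proj y)) *: (y - proj y).
  have y'y : edist y' y = del.
    rewrite /Defs.edist addrAC subrr add0r enormZ -/(Defs.edist y (proj y)).
    by rewrite ger0_norm ?divfK ?gt_eqF// divr_ge0// ltW.
  have y'c : edist y' c <= edist y c + del.
    by rewrite -y'y addrC; exact: edist_triangle.
  have By' : B y' by rewrite /B /=; lra.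
  have dy' : d y + (1 + lam) / 2 * del <= d y'.
    by apply: etaP; [rewrite del0|exact: (projP y').1].
  have := ymax y' (mem_set By').
  have : lam * edist y' c <= lam * (edist y c + del) by rewrite ler_wpM2l// ltW.
  have : 0 < (1 - lam) * del by rewrite mulr_gt0// subr_gt0.
  lra.
have [|y /set_mem By ymax] := @EVT_max_rV _ _ d B (ex_intro _ c Bc) cB.
  exact: continuous_subspaceT.
exists y => // q Sq; apply: le_trans (dmin _ _ Sq); rewrite -dc.
rewrite leNgt; apply/negP => dytau.
have dcy : d c <= d y by apply: ymax; exact: mem_set.
(* Midpoint of 1 and the rate attained by the maximum of [d], so that [reach lam] exceeds this
   maximum. *)
pose lam := (1 + (d y - d c) / tau) / 2.
have m1 : (d y - d c) / tau < 1 by rewrite ltr_pdivrMr//; lra.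
have m0 : 0 <= (d y - d c) / tau by rewrite divr_ge0 ?subr_ge0// ltW.
have [|y1 By1] := reach lam; first by rewrite /lam; apply/andP; split; lra.
have := ymax y1 (mem_set By1).
have : (d y - d c) / tau * tau = d y - d c by rewrite divfK ?gt_eqF.
have : (d y - d c) / tau * tau < lam * tau.
  by rewrite ltr_pM2r// /lam; lra.
lra.
Qed.

(** Expanding the square of [v + w - q] makes nearness an inequality linear in [w], so that it can
    be followed along a ray. *)
Lemma nearestP (S : set 'rV[R]_3) (v w : 'rV[R]_3) : S v ->
  nearest S (v + w) v <-> forall q, S q -> 2 * dotv (q - v) w <= dotv (q - v) (q - v).
Proof.
move=> Sv.
have E q : dotv (v + w - q) (v + w - q) =
    dotv w w + (dotv (q - v) (q - v) - 2 * dotv (q - v) w).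
  by rewrite !dotvE !(dotvC _ v) !(dotvC _ w); ring.
have le q : (edist (v + w) v <= edist (v + w) q) =
    (2 * dotv (q - v) w <= dotv (q - v) (q - v)).
  by rewrite /Defs.edist enorm_le_sqr addrAC subrr add0r E lerDl subr_ge0.
by split=> [[_ H] q /H|H]; [|split=> // q /H]; rewrite le.
Qed.

(* The point [y] of [nearest_push] is within [tau] of [c] and at least
   [enorm w + tau] from [v], so it lies on the ray from [v] through [c]. *)
Lemma nearest_extend (S : set 'rV[R]_3) (v w : 'rV[R]_3) :
  compact S -> nearest S (v + w) v -> w != 0 -> ~ medial_axis S (v + w) ->
  exists2 k, 1 < k & nearest S (v + k *: w) v.
Proof.
move=> cS [Sv vmin] w0 Mc; set c := v + w in vmin Mc.
have w_gt0 : 0 < enorm w by rewrite enorm_gt0.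
have cv : edist c v = enorm w by rewrite /Defs.edist /c addrAC subrr add0r.
(* A point outside a closure has a neighborhood that misses the set; this is the ball of uniqueness
   that [nearest_push] asks for. *)
have [e e0 eP] : exists2 e, 0 < e & forall y, edist y c < e ->
    ~ exists p q, [/\ p <> q, nearest S y p & nearest S y q].
  apply/nbhs_edistP; apply: contrapT => H; apply: Mc => A /nbhs_edistP[e e0 eA].
  apply: contrapT => AM; apply: H; apply/nbhs_edistP; exists e => // y yc ym.
  by apply: AM; exists y; split => //; exact: eA.
pose tau := Num.min (e / 2) (enorm w / 2).
have tau0 : 0 < tau by rewrite lt_min !divr_gt0.
have taue : tau < e by rewrite gt_min; apply/orP; left; lra.
have tauw : tau < enorm w by rewrite gt_min; apply/orP; right; lra.
have [| |y yc ymin] := @nearest_push _ S v c tau cS Sv vmin.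
- by rewrite tau0 cv tauw.
- move=> y p q yc Sp Sq pmin qmin; apply: contrapT => pq.
  apply: (eP y); first exact: le_lt_trans yc _.
  by exists p, q.
pose g := (tau / enorm w) *: w.
exists (1 + tau / enorm w); first by rewrite ltrDl divr_gt0.
suff <- : y = v + (1 + tau / enorm w) *: w.
  split=> // q Sq; apply: le_trans (ymin _ Sq).
  apply: le_trans (edist_triangle c _ _) _.
  by rewrite addrC lerD2l.
have gg : dotv g g = tau ^+ 2.
  by rewrite /g !dotvE -enorm_sqr; field; rewrite gt_eqF.
(* Together with [edist y c <= tau] this is equality in Cauchy-Schwarz for [y - c] and [w], which
   forces [y - c = g]. *)
have ycw : tau * enorm w <= dotv (y - c) w.
  have := ymin _ Sv; rewrite cv.
  have : edist y v ^+ 2 = edist y c ^+ 2 + 2 * dotv (y - c) w + enorm w ^+ 2.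
    have yv : y - v = (y - c) + w by rewrite /c opprD addrA subrK.
    by rewrite !edist_sqr enorm_sqr yv dotv_sqrD.
  have := edist_ge0 y v; have := edist_ge0 y c.
  move: (edist y v) (edist y c) yc => B A At A0 B0 E le1.
  nra.
apply/eqP; rewrite scalerDl scale1r addrA -/c -/g -subr_eq0 opprD addrA -dotv_eq0.
rewrite eq_le dotv_ge0 andbT.
rewrite dotv_sqrD !dotvNr dotvNl opprK gg -edist_sqr.
have : tau * tau <= dotv (y - c) g.
  by rewrite /g dotvZr mulrAC ler_pdivlMr// -mulrA ler_wpM2l// ltW.
have : edist y c ^+ 2 <= tau ^+ 2 by rewrite lerXn2r ?nnegrE ?edist_ge0// ltW.
lra.
Qed.

(** By [nearestP] the parameters [t] at which [v] is nearest are cut out by inequalities linear in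
    [t], so their supremum is attained, and [p] makes it finite. Off the medial axis
    [nearest_extend] would pass it. The final inequality is the constraint of [p] at this
    supremum. *)
Lemma medial_point_on_ray (S : set 'rV[R]_3) (v p w : 'rV[R]_3) (t0 : R) :
  compact S -> S p -> w != 0 -> 0 < dotv (p - v) w ->
  0 < t0 -> nearest S (v + t0 *: w) v ->
  exists2 t, 0 < t & medial_axis S (v + t *: w) /\
    2 * t * dotv (p - v) w <= dotv (p - v) (p - v).
Proof.
move=> cS Sp w0 h0 t00 near0; have Sv : S v by case: near0.
pose T := [set t | nearest S (v + t *: w) v].
have TP t : T t <-> forall q, S q -> 2 * t * dotv (q - v) w <= dotv (q - v) (q - v).
  rewrite /T /= nearestP//.
  by split => H q /H; rewrite dotvZr mulrA.
have ubT q : S q -> 0 < dotv (q - v) w ->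
    ubound T (dotv (q - v) (q - v) / (2 * dotv (q - v) w)).
  move=> Sq hq t /TP/(_ q Sq) tq; rewrite ler_pdivlMr ?mulr_gt0//.
  by rewrite mulrCA mulrA.
have hsT : has_sup T.
  by split; [exists t0|exists (dotv (p - v) (p - v) / (2 * dotv (p - v) w)); exact: ubT].
have t0le : t0 <= sup T by apply: sup_upper_bound.
have supT : T (sup T).
  apply/TP => q Sq; have [hq|hq] := leP (dotv (q - v) w) 0.
    apply: le_trans (dotv_ge0 _); rewrite mulr_ge0_le0// mulr_ge0//.
    by rewrite (le_trans (ltW t00)).
  have := sup_le_ub (ex_intro _ t0 near0) (ubT q Sq hq).
  by rewrite ler_pdivlMr ?mulr_gt0// mulrCA mulrA.
have st0 : 0 < sup T by exact: lt_le_trans t0le.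
exists (sup T) => //; split; last by move/TP: supT; exact.
apply: contrapT => Mt.
have [|k k1] := nearest_extend cS supT _ Mt.
  by rewrite scaler_eq0 negb_or w0 gt_eqF.
rewrite scalerA => /(sup_upper_bound hsT).
by rewrite leNgt ltr_pMl ?k1.
Qed.

End Nearest.

(** * Mean value theorem along segments *)

Section Calculus.
Variable R : realType.

Lemma edist_segment n (u u' u0 : 'rV[R]_n) (rho s : R) :
  edist u u0 < rho -> edist u' u0 < rho -> 0 <= s <= 1 ->
  edist (u + s *: (u' - u)) u0 < rho.
Proof.
move=> ur u'r /andP[s0 s1].
have -> : edist (u + s *: (u' - u)) u0 =
    enorm ((1 - s) *: (u - u0) + s *: (u' - u0)).
  congr enorm; apply/rowP => i; rewrite !mxE; ring.
apply: le_lt_trans (enorm_triangle _ _) _.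
rewrite !enormZ (ger0_norm s0) ger0_norm ?subr_ge0//.
rewrite -!/(Defs.edist _ _).
have [->|sn0] := eqVneq s 0; first by rewrite subr0 mul1r mul0r addr0.
have sp : 0 < s by rewrite lt_def sn0.
have : s * edist u' u0 < s * rho by rewrite ltr_pM2l.
have : (1 - s) * edist u u0 <= (1 - s) * rho by rewrite ler_wpM2l ?subr_ge0// ltW.
lra.
Qed.

Lemma is_derive_dotv_line m n (g : 'rV[R]_m.+1 -> 'rV[R]_n.+1) (y : 'rV[R]_n.+1)
    (u h : 'rV[R]_m.+1) (s : R) :
  derivable g (u + s *: h) h ->
  is_derive s 1 (fun s => dotv y (g (u + s *: h)))
    (dotv y ('D_h g (u + s *: h))).
Proof.
move=> dg.
have H : t^-1 *: (((fun s => dotv y (g (u + s *: h))) \o shift s) (t *: 1)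
    - dotv y (g (u + s *: h))) @[t --> 0^'] --> dotv y ('D_h g (u + s *: h)).
  have -> : (fun t : R => t^-1 *: (((fun s => dotv y (g (u + s *: h))) \o shift s)
      (t *: 1) - dotv y (g (u + s *: h)))) =
    (fun x => dotv y x) \o
    (fun t : R => t^-1 *: ((g \o shift (u + s *: h)) (t *: h) - g (u + s *: h))).
    apply/funext => t /=; rewrite dotvZr dotvDr dotvNr.
    congr (_ * (dotv y (g _) - _)).
    by rewrite /shift /= [t *: 1]mulr1 scalerDl addrCA.
  apply: cvg_comp; [exact: dg|exact: dotv_continuous].
by apply: DeriveDef; [exact: cvgP H|exact: cvg_lim H].
Qed.

(** The mean value equality fails for vector-valued maps, so the increment is tested against a fixed
    [y], on which [s] depends. *)
Lemma dotv_mean_value m n (g : 'rV[R]_m.+1 -> 'rV[R]_n.+1) (y : 'rV[R]_n.+1)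
    (u u' : 'rV[R]_m.+1) :
  (forall s, 0 <= s <= 1 -> differentiable g (u + s *: (u' - u))) ->
  exists2 s, 0 <= s <= 1 &
    dotv y (g u' - g u) = dotv y ('D_(u' - u) g (u + s *: (u' - u))).
Proof.
move=> dg.
pose f (s : R) := dotv y (g (u + s *: (u' - u))).
pose df (s : R) := dotv y ('D_(u' - u) g (u + s *: (u' - u))).
have D (s : R) : s \in `[0, 1] -> is_derive s 1 f (df s).
  rewrite in_itv /= => /dg /diff_derivable dgs; apply: is_derive_dotv_line.
  exact: dgs.
have f_cont : {within `[0, 1], continuous f}.
  by apply: derivable_within_continuous => s /D[].
have D' (s : R) : s \in `]0, 1[ -> is_derive s 1 f (df s).
  by move=> s01; apply: D; exact: subset_itv_oo_cc s01.
have [s] := MVT_segment ler01 D' f_cont.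
rewrite in_itv /= => s01; rewrite subr0 mulr1 /f => fE.
exists s => //; rewrite dotvDr dotvNr -/(df s) -fE.
by rewrite scale1r scale0r addr0 subrKC.
Qed.

(** Stands in for letting [e] tend to 0 in a first-order estimate with error [e * c]. *)
Lemma le0_of_small (a c e0 : R) : 0 < e0 ->
  (forall e, 0 < e < e0 -> a <= e * c) -> a <= 0.
Proof.
move=> e00 H; rewrite leNgt; apply/negP => a0.
have c0 : 0 < `|c| + 1 by rewrite ltr_wpDl.
pose e := Num.min (e0 / 2) (a / (`|c| + 1) / 2).
have e_gt0 : 0 < e by rewrite lt_min !divr_gt0.
have ee0 : e < e0 by rewrite gt_min; apply/orP; left; lra.
have := H e; rewrite e_gt0 ee0 => /(_ isT).
apply/negP; rewrite -ltNge.
apply: (@le_lt_trans _ _ (e * (`|c| + 1))).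
  by rewrite ler_wpM2l ?ltW// (le_lt_trans (ler_norm _))// ltrDl.
rewrite -ltr_pdivlMr//; apply: le_lt_trans (_ : a / (`|c| + 1) / 2 < _).
  by rewrite ge_min lexx orbT.
by rewrite ltr_pdivrMr// ltr_pMr ?divr_gt0// ltr1n.
Qed.

End Calculus.

(** * Lipschitz estimates for maps of two parameters *)

Section Chart.
Variable R : realType.

Local Notation e0 := ('e_(0 : 'I_2) : 'rV[R]_2).
Local Notation e1 := ('e_(1 : 'I_2) : 'rV[R]_2).

Lemma row2E (h : 'rV[R]_2) : h = h 0 0 *: e0 + h 0 1 *: e1.
Proof.
rewrite [LHS]row_sum_delta !big_ord_recl big_ord0 addr0.
by congr (_ + h 0 _ *: 'e__); apply: val_inj.
Qed.

(** [Ck_on] controls each directional derivative separately; reduction to two basis directions makes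
    the bounds below uniform in [h]. *)
Lemma derive_row2E n (g : 'rV[R]_2 -> 'rV[R]_n.+1) z h : differentiable g z ->
  'D_h g z = h 0 0 *: 'D_e0 g z + h 0 1 *: 'D_e1 g z.
Proof.
move=> dg; rewrite !deriveE// {1}[h]row2E.
by rewrite linearD !linearZ.
Qed.

Lemma open_edist_ball m (U : set 'rV[R]_m.+1) u0 : open U -> U u0 ->
  exists2 rho, 0 < rho & forall u, edist u u0 < rho -> U u.
Proof. by move=> oU Uu; apply/nbhs_edistP; exact: open_nbhs_nbhs. Qed.

Lemma C1_lipschitz n (U : set 'rV[R]_2) (g : 'rV[R]_2 -> 'rV[R]_n.+1) u0 :
  open U -> U u0 -> Ck_on 1 U g ->
  exists rho K, [/\ 0 < rho, 0 <= K, forall u, edist u u0 < rho -> U u &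
    forall u u', edist u u0 < rho -> edist u' u0 < rho ->
      edist (g u') (g u) <= K * edist u' u].
Proof.
move=> oU Uu0 [dg cg].
have bnd e : exists M d : R, [/\ 0 <= M, 0 < d & forall u, edist u u0 < d ->
    enorm ('D_e g u) <= M].
  have /nbhs_edistP : nbhs u0 ((fun u => 'D_e g u) @^-1`
      [set x | edist x ('D_e g u0) < 1]).
    by apply: (cg e u0 Uu0); apply/nbhs_edistP; exists 1.
  move=> [d d0 dP]; exists (enorm ('D_e g u0) + 1), d.
  split=> [||u /dP /= h]; [by rewrite addr_ge0 ?enorm_ge0|exact: d0|].
  rewrite addrC -lerBlDr.
  apply: le_trans (ltW h); rewrite lerBlDr.
  by rewrite -[X in enorm X <= _](subrK ('D_e g u0)) enorm_triangle.
have [M0 [d0 [M00 d00 b0]]] := bnd e0; have [M1 [d1 [M10 d10 b1]]] := bnd e1.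
have [d2 d20 dU] := open_edist_ball oU Uu0.
pose rho := Num.min d0 (Num.min d1 d2).
have rho0 : 0 < rho by rewrite !lt_min d00 d10.
have rd0 : rho <= d0 by rewrite ge_min lexx.
have rd1 : rho <= d1 by rewrite !ge_min lexx orbT.
have rd2 : rho <= d2 by rewrite !ge_min lexx !orbT.
exists rho, (M0 + M1); split => //.
- exact: addr_ge0.
- by move=> u ur; apply: dU; apply: lt_le_trans ur rd2.
move=> u u' ur u'r; set h := u' - u.
(* Tested against the increment itself, the mean value theorem bounds the norm of the increment. *)
have [s s01|s s01 E] := @dotv_mean_value R _ _ g (g u' - g u) u u'.
  by apply: dg; apply: dU; apply: lt_le_trans rd2; exact: edist_segment.
have sr := edist_segment ur u'r s01.
have Dle : enorm ('D_h g (u + s *: h)) <= (M0 + M1) * enorm h.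
  rewrite derive_row2E; last first.
    by apply: dg; apply: dU; exact: lt_le_trans rd2.
  have c0 : enorm (h 0 0 *: 'D_e0 g (u + s *: h)) <= M0 * enorm h.
    rewrite enormZ mulrC; apply: ler_pM; rewrite ?enorm_ge0 ?normr_coord_le_enorm//.
    by apply: b0; apply: lt_le_trans sr rd0.
  have c1 : enorm (h 0 1 *: 'D_e1 g (u + s *: h)) <= M1 * enorm h.
    rewrite enormZ mulrC; apply: ler_pM; rewrite ?enorm_ge0 ?normr_coord_le_enorm//.
    by apply: b1; apply: lt_le_trans sr rd1.
  rewrite (mulrDl M0 M1 (enorm h)).
  exact: le_trans (enorm_triangle _ _) (lerD c0 c1).
have [E0|E0] := eqVneq (edist (g u') (g u)) 0.
  by rewrite E0 mulr_ge0 ?edist_ge0// addr_ge0.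
rewrite -(@ler_pM2l _ (edist (g u') (g u))) ?lt_def ?E0 ?edist_ge0//.
rewrite -expr2 {1}/Defs.edist enorm_sqr E.
apply: le_trans (dotv_le _ _) _.
by rewrite ler_wpM2l ?enorm_ge0.
Qed.

Lemma edist_comb_le n (a b H d K0 K1 : R) (p p' q q' : 'rV[R]_n) :
  `|a| <= H -> `|b| <= H -> edist p' p <= K0 * d -> edist q' q <= K1 * d ->
  edist (a *: p' + b *: q') (a *: p + b *: q) <= (K0 + K1) * H * d.
Proof.
move=> aH bH pd qd; rewrite /Defs.edist opprD addrACA -!scalerBr.
apply: le_trans (enorm_triangle _ _) _; rewrite !enormZ.
have : `|a| * enorm (p' - p) <= H * (K0 * d) by rewrite ler_pM ?enorm_ge0.
have : `|b| * enorm (q' - q) <= H * (K1 * d) by rewrite ler_pM ?enorm_ge0.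
lra.
Qed.

Lemma C2_derive_lipschitz n (U : set 'rV[R]_2) (psi : 'rV[R]_2 -> 'rV[R]_n.+1) u0 :
  open U -> U u0 -> Ck_on 2 U psi ->
  exists rho K, [/\ 0 < rho, 0 <= K, forall u, edist u u0 < rho -> U u &
    forall u u' h, edist u u0 < rho -> edist u' u0 < rho ->
      edist ('D_h psi u') ('D_h psi u) <= K * enorm h * edist u' u].
Proof.
move=> oU Uu0 [dpsi C1].
have [r0 [K0 [r00 K00 rU0 L0]]] := C1_lipschitz oU Uu0 (C1 e0).
have [r1 [K1 [r10 K10 rU1 L1]]] := C1_lipschitz oU Uu0 (C1 e1).
pose rho := Num.min r0 r1.
have rho0 : 0 < rho by rewrite lt_min r00.
have rr0 : rho <= r0 by rewrite ge_min lexx.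
have rr1 : rho <= r1 by rewrite ge_min lexx orbT.
exists rho, (K0 + K1); split => //.
- by rewrite addr_ge0.
- by move=> u ur; apply: rU0; exact: lt_le_trans rr0.
move=> u u' h ur u'r.
have DE z : edist z u0 < rho -> 'D_h psi z = h 0 0 *: 'D_e0 psi z + h 0 1 *: 'D_e1 psi z.
  by move=> zr; apply: derive_row2E; apply: dpsi; apply: rU0; apply: lt_le_trans zr rr0.
rewrite (DE _ ur) (DE _ u'r).
apply: edist_comb_le; [exact: normr_coord_le_enorm|exact: normr_coord_le_enorm| |].
- by apply: L0; [apply: lt_le_trans ur rr0|apply: lt_le_trans u'r rr0].
- by apply: L1; [apply: lt_le_trans ur rr1|apply: lt_le_trans u'r rr1].
Qed.

(** The constant is the square root of trace over determinant of the Gram matrix, which dominates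
    the inverse of its smallest eigenvalue. The two squares in the last step add up to the squared
    norm of the Gram matrix applied to [h], exactly the difference of the two sides. *)
Lemma enorm_le_comb (A B : 'rV[R]_3) : cross A B != 0 ->
  exists2 L, 0 < L & forall h : 'rV[R]_2,
    enorm h <= L * enorm (h 0 0 *: A + h 0 1 *: B).
Proof.
move=> N0; pose G := dotv (cross A B) (cross A B).
have G0 : 0 < G by rewrite dotv_gt0.
have GE : G = dotv A A * dotv B B - dotv A B ^+ 2 by exact: dotv_cross.
pose k := (dotv A A + dotv B B) / G.
have k0 : 0 < k.
  have := dotv_ge0 A; have := dotv_ge0 B; have := sqr_ge0 (dotv A B) => ? ? ?.
  rewrite divr_gt0//; nra.
exists (Num.sqrt k) => [|h]; first by rewrite sqrtr_gt0.
rewrite /enorm -(sqrtrM _ (ltW k0)); apply: ler_wsqrtr.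
rewrite /k mulrAC ler_pdivlMr// dotv_sqrD !dotvZl !dotvZr.
have -> : dotv h h = h 0 0 ^+ 2 + h 0 1 ^+ 2.
  rewrite /dotv !big_ord_recl big_ord0 addr0 !expr2.
  by congr (_ + h 0 _ * h 0 _); apply: val_inj.
rewrite GE; move: (h 0 0) (h 0 1) (dotv A A) (dotv B B) (dotv A B) => a b p q r.
have := sqr_ge0 (a * p + b * r); have := sqr_ge0 (a * r + b * q); nra.
Qed.

End Chart.

(** * Tangent vectors and second-order contact of a smooth surface *)

Section Surface.
Variable R : realType.

Local Notation e0 := ('e_(0 : 'I_2) : 'rV[R]_2).
Local Notation e1 := ('e_(1 : 'I_2) : 'rV[R]_2).

Lemma line_differentiable (V : normedModType R) (u h : V) (t : R) :
  differentiable (fun s : R => u + s *: h) t.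
Proof. by []. Qed.

Lemma line_continuous (V : normedModType R) (u h : V) :
  continuous (fun s : R => u + s *: h).
Proof. by move=> t; apply: differentiable_continuous; exact: line_differentiable. Qed.

(** The difference quotients coincide, whence an equality of functions, as the induction on [k] in
    [Ck_on_comp_line] requires. *)
Lemma derive_comp_line (V W : normedModType R) (f : V -> W) (u h : V) (s : R) :
  'D_s (fun t : R => f (u + t *: h)) = (fun t : R => 'D_(s *: h) f (u + t *: h)).
Proof.
apply/funext => t; rewrite /derive.
apply: (congr1 (fun F : R -> W => lim (F r @[r --> 0^']))); apply/funext => r /=.
by rewrite /shift /= scalerDl -scalerA addrCA.
Qed.

Lemma Ck_on_comp_line (V W : normedModType R) k (U : set V) (f : V -> W) (u h : V) :
  Ck_on k U f ->
  Ck_on k [set t : R | U (u + t *: h)] (fun t : R => f (u + t *: h)).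
Proof.
elim: k f => [|k IH] f /=.
  move=> fc t Ut; apply: continuous_comp; last exact: fc.
  exact: line_continuous.
move=> [df IHf]; split=> [t Ut|s].
  by apply: differentiable_comp; [exact: line_differentiable|exact: df].
by rewrite derive_comp_line; apply: (IH ('D_(s *: h) f)); exact: IHf.
Qed.

Lemma tangent_vector_param (S : set 'rV[R]_3) (U : set 'rV[R]_2) psi u h :
  open U -> U u -> smooth_on U psi -> psi @` U `<=` S ->
  tangent_vector S (psi u) ('D_h psi u).
Proof.
move=> oU Uu spsi SU; exists [set t : R | U (u + t *: h)], (fun t => psi (u + t *: h)).
split.
- split; last by rewrite /= scale0r addr0.
  apply: (@open_comp _ _ (fun t : R => u + t *: h)) => // t _.
  exact: line_continuous.
- by move=> k; exact: Ck_on_comp_line.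
- by move=> t Ut; apply: SU; exists (u + t *: h).
- by rewrite scale0r addr0.
- rewrite derive1E; apply: etrans (congr1 (@^~ 0) (derive_comp_line psi u h 1)) _.
  by rewrite scale1r scale0r addr0.
Qed.

(** The intermediate point of the mean value theorem is at most [enorm (u' - u)] away from [u], so
    the Lipschitz bound on the derivative gives the remainder, without the factor 1/2 of Taylor's
    formula. *)
Lemma param_taylor (psi : 'rV[R]_2 -> 'rV[R]_3) (u0 : 'rV[R]_2) (rho K : R) y u u' :
  0 <= K ->
  (forall u, edist u u0 < rho -> differentiable psi u) ->
  (forall u u' h, edist u u0 < rho -> edist u' u0 < rho ->
      edist ('D_h psi u') ('D_h psi u) <= K * enorm h * edist u' u) ->
  edist u u0 < rho -> edist u' u0 < rho ->
  `|dotv y (psi u' - psi u) - dotv y ('D_(u' - u) psi u)| <=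
    K * enorm y * enorm (u' - u) ^+ 2.
Proof.
move=> K0 dpsi lip ur u'r.
have [s s01|s s01 ->] := @dotv_mean_value R _ _ psi y u u'.
  by apply: dpsi; exact: edist_segment.
rewrite -dotvNr -dotvDr; apply: le_trans (normr_dotv_le _ _) _.
rewrite [K * _]mulrC -mulrA ler_wpM2l ?enorm_ge0//.
apply: le_trans (lip _ _ _ ur _) _; first exact: edist_segment.
rewrite expr2 mulrA ler_wpM2l ?mulr_ge0 ?enorm_ge0//.
rewrite /Defs.edist addrAC subrr add0r enormZ.
by case/andP: s01 => s0 s1; rewrite ger0_norm// ler_piMl ?enorm_ge0.
Qed.

(* Tested against [y = 'D_h psi u0], the increment of [psi] is at least
   [enorm y ^+ 2] up to the variation of the derivative. *)
Lemma param_expanding (psi : 'rV[R]_2 -> 'rV[R]_3) (u0 : 'rV[R]_2) (rho K L : R) u u' :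
  0 <= K -> 0 < L -> K * rho * L <= 1 / 2 ->
  (forall u, edist u u0 < rho -> differentiable psi u) ->
  (forall u u' h, edist u u0 < rho -> edist u' u0 < rho ->
      edist ('D_h psi u') ('D_h psi u) <= K * enorm h * edist u' u) ->
  (forall h, enorm h <= L * enorm ('D_h psi u0)) ->
  edist u u0 < rho -> edist u' u0 < rho ->
  edist u' u <= 2 * L * edist (psi u') (psi u).
Proof.
move=> K0 L0 KL dpsi lip hL ur u'r.
rewrite /Defs.edist; set h := u' - u; set y := 'D_h psi u0.
have u0r : edist u0 u0 < rho.
  by rewrite edistxx; apply: le_lt_trans ur; exact: edist_ge0.
have [s s01|s s01 E] := @dotv_mean_value R _ _ psi y u u'.
  by apply: dpsi; exact: edist_segment.
set z := u + s *: (u' - u) in E.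
have zr : edist z u0 < rho by exact: edist_segment.
have Dz : edist ('D_h psi z) y <= K * enorm h * rho.
  apply: le_trans (lip _ _ _ u0r zr) _.
  by rewrite ler_wpM2l ?mulr_ge0 ?enorm_ge0// ltW.
have hy := hL h; rewrite -/y in hy.
have : enorm y * (enorm y - K * enorm h * rho) <= enorm y * enorm (psi u' - psi u).
  apply: le_trans (dotv_le _ _); rewrite E -[X in dotv y X](subrK y) dotvDr -enorm_sqr.
  have := normr_dotv_le y ('D_h psi z - y); rewrite ler_norml => /andP[+ _].
  have : enorm y * enorm ('D_h psi z - y) <= enorm y * (K * enorm h * rho).
    by rewrite ler_wpM2l ?enorm_ge0.
  rewrite -/h expr2; lra.
have [y0|y0] := eqVneq (enorm y) 0.
  move: hy; rewrite y0 mulr0 => h0 _; apply: le_trans h0 _.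
  by rewrite !mulr_ge0 ?enorm_ge0// ltW.
rewrite ler_pM2l ?lt_def ?y0 ?enorm_ge0// => H.
have : enorm h * (K * rho * L) <= enorm h * (1 / 2) by rewrite ler_wpM2l ?enorm_ge0.
have : L * (enorm y - K * enorm h * rho) <= L * enorm (psi u' - psi u).
  by rewrite ler_wpM2l// ltW.
lra.
Qed.

Lemma nearest_ineq (S : set 'rV[R]_3) x p q : nearest S x p -> S q ->
  2 * dotv (x - p) (q - p) <= edist q p ^+ 2.
Proof.
move=> np Sq; have Sp := np.1.
rewrite -[x](subrKC p) in np; move/(nearestP _ Sp) : np => /(_ q Sq).
by rewrite dotvC edist_sqr.
Qed.

(** Moving the parameter by [e *: h], nearness bounds the first-order term by quadratic ones, and
    [e] tends to 0. Applied to [h] and [- h] it says that [x - psi u] is normal to the surface. *)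
Lemma nearest_param_first_order (S : set 'rV[R]_3) (psi : 'rV[R]_2 -> 'rV[R]_3)
    (u0 : 'rV[R]_2) (rho K K1 : R) x u h :
  0 <= K -> 0 <= K1 ->
  (forall u, edist u u0 < rho -> differentiable psi u) ->
  (forall u, edist u u0 < rho -> S (psi u)) ->
  (forall u u', edist u u0 < rho -> edist u' u0 < rho ->
      edist (psi u') (psi u) <= K1 * edist u' u) ->
  (forall u u' h, edist u u0 < rho -> edist u' u0 < rho ->
      edist ('D_h psi u') ('D_h psi u) <= K * enorm h * edist u' u) ->
  edist u u0 < rho -> nearest S x (psi u) ->
  dotv (x - psi u) ('D_h psi u) <= 0.
Proof.
move=> K0 K10 dpsi Spsi lip1 lip ur near.
set y := x - psi u.
have h0 : 0 < enorm h + 1 by rewrite ltr_wpDl ?enorm_ge0.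
have gap : 0 < rho - edist u u0 by rewrite subr_gt0.
apply: (@le0_of_small _ _ (K * enorm y * enorm h ^+ 2 + (K1 * enorm h) ^+ 2 / 2)
  ((rho - edist u u0) / (enorm h + 1))); first by rewrite divr_gt0.
move=> e /andP[e_gt0]; rewrite ltr_pdivlMr// => ee.
pose u' := u + e *: h.
have u'u : u' - u = e *: h by rewrite /u' addrAC subrr add0r.
have nu'u : edist u' u = e * enorm h by rewrite /Defs.edist u'u enormZ gtr0_norm.
have u'r : edist u' u0 < rho.
  apply: le_lt_trans (edist_triangle u _ _) _; rewrite nu'u; lra.
have := nearest_ineq near (Spsi _ u'r).
have : edist (psi u') (psi u) ^+ 2 <= (K1 * (e * enorm h)) ^+ 2.
  by rewrite lerXn2r ?nnegrE ?edist_ge0// -nu'u ?lip1// mulr_ge0// edist_ge0.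
have := param_taylor y K0 dpsi lip ur u'r.
have -> : 'D_(u' - u) psi u = e *: 'D_h psi u.
  have du := dpsi _ ur; rewrite !(deriveE _ du) u'u.
  by rewrite linearZ.
rewrite ler_norml -/(Defs.edist u' u) nu'u dotvZr => /andP[+ _].
rewrite -/y => H1 H2 H3.
rewrite -(ler_pM2l e_gt0).
rewrite !exprMn in H1 H2 *; lra.
Qed.

(** Later arguments see the chart only through these conclusions. The last one is a contact estimate
    uniform over the feet [p] near [v]: points close to [v] may have nearest points other than
    [v]. *)
Lemma surface_chart (S : set 'rV[R]_3) v : smooth_surface S -> S v ->
  exists A B r C, [/\ cross A B != 0, 0 < r /\ 0 <= C,
    (forall a b : R, tangent_vector S v (a *: A + b *: B)),
    (forall q, S q -> edist q v < r ->
      `|dotv (cross A B) (q - v)| <= C * edist q v ^+ 2) &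
    (forall x p q, edist p v < r -> edist q v < r -> nearest S x p -> S q ->
      dotv (x - p) (q - p) <= C * edist x p * edist q p ^+ 2)].
Proof.
move=> smS Sv.
have [V [U [psi [oV Vv oU [spsi inj_d im_psi [chi [chi_c chiK]]]]]]] := smS v Sv.
have [u0 Uu0 psi_u0] : (psi @` U) v by rewrite im_psi.
have [r0 [K [r00 K0 rU0 lip]]] := C2_derive_lipschitz oU Uu0 (spsi 2).
have [r1 [K1 [r10 K10 rU1 lip1]]] := C1_lipschitz oU Uu0 (spsi 1%N).
have dpsi u : U u -> differentiable psi u by exact: (spsi 1%N).1.
set A := 'D_e0 psi u0; set B := 'D_e1 psi u0.
have DE h : 'D_h psi u0 = h 0 0 *: A + h 0 1 *: B.
  by apply: derive_row2E; exact: dpsi.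
have SU : psi @` U `<=` S by rewrite im_psi => ? [].
have N0 : cross A B != 0.
  have inj := inj_d _ Uu0.
  have ker h : 'D_h psi u0 = 0 -> h = 0.
    by rewrite (deriveE _ (dpsi _ Uu0)) => dh; apply: inj; rewrite dh linear0.
  have B0 : B != 0.
    apply/eqP => /ker /rowP /(_ 1); rewrite !mxE /= => /eqP.
    by rewrite oner_eq0.
  apply/eqP => /cross_eq0 /(_ B0) AB.
  have /ker /rowP/(_ 0) : 'D_(e0 - (dotv A B / dotv B B) *: e1) psi u0 = 0.
    have du := dpsi _ Uu0.
    rewrite (deriveE _ du) linearB linearZ /= -!(deriveE _ du).
    by rewrite -/A -/B {1}AB subrr.
  by rewrite !mxE /= mulr0 subr0 => /eqP; rewrite oner_eq0.
have [L L0 hL] := enorm_le_comb N0.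
have hL' h : enorm h <= L * enorm ('D_h psi u0) by rewrite DE.
have KL0 : 0 < 2 * (K * L + 1) by rewrite mulr_gt0// ltr_wpDl// mulr_ge0// ltW.
(* The last term gives [K * rho * L <= 1 / 2], the hypothesis of [param_expanding]. *)
pose rho := Num.min (Num.min r0 r1) (1 / (2 * (K * L + 1))).
have rho0 : 0 < rho by rewrite !lt_min r00 r10 divr_gt0.
have rr0 : rho <= r0 by rewrite !ge_min lexx.
have rr1 : rho <= r1 by rewrite !ge_min lexx orbT.
have rKL : K * rho * L <= 1 / 2.
  have : rho <= 1 / (2 * (K * L + 1)) by rewrite !ge_min lexx !orbT.
  rewrite ler_pdivlMr//; lra.
have w0 u : edist u u0 < rho -> edist u u0 < r0 by move=> /lt_le_trans; apply.
have w1 u : edist u u0 < rho -> edist u u0 < r1 by move=> /lt_le_trans; apply.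
have rU u : edist u u0 < rho -> U u by move/w0; exact: rU0.
have dpsi' u : edist u u0 < rho -> differentiable psi u by move/rU; exact: dpsi.
have Spsi u : edist u u0 < rho -> S (psi u) by move/rU => Uu; apply: SU; exists u.
have lip' u u' h : edist u u0 < rho -> edist u' u0 < rho ->
    edist ('D_h psi u') ('D_h psi u) <= K * enorm h * edist u' u.
  by move=> /w0 ? /w0 ?; exact: lip.
have lip1' u u' : edist u u0 < rho -> edist u' u0 < rho ->
    edist (psi u') (psi u) <= K1 * edist u' u.
  by move=> /w1 ? /w1 ?; exact: lip1.
have expd u u' : edist u u0 < rho -> edist u' u0 < rho ->
    edist u' u <= 2 * L * edist (psi u') (psi u).
  exact: (param_expanding K0 L0 rKL dpsi' lip' hL').
(* Continuity of the inverse chart keeps other sheets away: every point of [S] close to [v] has its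
   parameter close to [u0]. *)
have [r r_gt0 rP] : exists2 r, 0 < r & forall q, S q -> edist q v < r ->
    exists2 u, edist u u0 < rho & psi u = q.
  have chi_v : chi v = u0 by rewrite -psi_u0 chiK.
  have [d1 d10 dV] := open_edist_ball oV Vv.
  have /nbhs_edistP[d2 d20 dchi] :
      within (S `&` V) (nbhs v) (chi @^-1` [set u | edist u u0 < rho]).
    move/subspace_continuousP : chi_c => /(_ v (conj Sv Vv)); apply.
    have : nbhs (chi v) [set u | edist u u0 < rho].
      by rewrite chi_v; apply/nbhs_edistP; exists rho.
    exact.
  exists (Num.min d1 d2); first by rewrite lt_min d10.
  move=> q Sq; rewrite lt_min => /andP[/dV Vq /dchi qchi].
  have SVq : (S `&` V) q by [].
  have [u Uu uq] : (psi @` U) q by rewrite im_psi.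
  exists u => //; rewrite -(chiK _ Uu) uq; exact: qchi.
(* The expansion factor [2 * L] converts an error quadratic in the parameters into one quadratic in
   the distance in space. *)
pose C := K * (2 * L) ^+ 2.
have C0 : 0 <= C by rewrite mulr_ge0// sqr_ge0.
have quad u u' (y : 'rV[R]_3) : edist u u0 < rho -> edist u' u0 < rho ->
    K * enorm y * enorm (u' - u) ^+ 2 <=
    C * enorm y * edist (psi u') (psi u) ^+ 2.
  move=> ur u'r.
  rewrite /C -mulrA -[X in _ <= X]mulrA -mulrA ler_wpM2l//.
  rewrite [X in _ <= X]mulrCA ler_wpM2l ?enorm_ge0// -exprMn.
  by rewrite lerXn2r ?nnegrE ?mulr_ge0 ?edist_ge0 ?enorm_ge0 ?expd// ltW.
(* The added 1 lets one constant serve both estimates, with and without the factor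
   [enorm (cross A B)]. *)
pose C' := C * (enorm (cross A B) + 1).
have C'0 : 0 <= C' by rewrite mulr_ge0// addr_ge0// enorm_ge0.
have u0r : edist u0 u0 < rho by rewrite edistxx.
exists A, B, r, C'; split => //.
- move=> a b; rewrite -psi_u0.
  suff -> : a *: A + b *: B = 'D_(a *: e0 + b *: e1) psi u0.
    exact: tangent_vector_param oU Uu0 spsi SU.
  by rewrite DE !mxE /= !mulr0 !mulr1 addr0 add0r.
- move=> q Sq /(rP q Sq)[u ur <-]; rewrite -psi_u0.
  have := param_taylor (cross A B) K0 dpsi' lip' u0r ur.
  have -> : dotv (cross A B) ('D_(u - u0) psi u0) = 0.
    by rewrite DE; exact: dotv_cross_comb.
  rewrite subr0 => H.
  apply: le_trans H _; apply: le_trans (quad u0 u (cross A B) u0r ur) _.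
  by rewrite /C' ler_wpM2r ?sqr_ge0// ler_wpM2l// lerDl.
- move=> x p q pr qr near Sq; have Sp := near.1.
  have [u ur up] := rP p Sp pr; have [u' u'r uq] := rP q Sq qr.
  subst p q.
  have := param_taylor (x - psi u) K0 dpsi' lip' ur u'r.
  have := nearest_param_first_order (u' - u) K0 K10 dpsi' Spsi lip1' lip' ur near.
  rewrite ler_norml => H1 /andP[_ H2].
  have := quad _ _ (x - psi u) ur u'r.
  have : C * edist x (psi u) * edist (psi u') (psi u) ^+ 2 <=
      C' * edist x (psi u) * edist (psi u') (psi u) ^+ 2.
    rewrite ler_wpM2r ?sqr_ge0// ler_wpM2r ?edist_ge0//.
    by rewrite /C' ler_peMr// lerDr enorm_ge0.
  rewrite /Defs.edist; lra.
Qed.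

End Surface.

(** * Tangent and normal spaces, and the empty ball inequality *)

Section EmptyBall.
Variable R : realType.

Lemma curve_near (c : R -> 'rV[R]_3) (J : set R) (v : 'rV[R]_3) (e r : R) :
  open J -> J 0 -> c 0 = v -> derivable c 0 1 -> {for 0, continuous c} ->
  0 < e -> 0 < r ->
  exists t, [/\ t != 0, `|t| < e, J t, edist (c t) v < r &
    edist (t^-1 *: (c t - v)) (derive1 c 0) < e].
Proof.
move=> oJ J0 c0 dc cc e_gt0 r_gt0.
have n1 : \forall t \near (0 : R)^', t != 0 by exact: nbhs_dnbhs_neq.
have n2 : \forall t \near (0 : R)^', `|t| < e by exact: dnbhs0_lt.
have n3 : \forall t \near (0 : R)^', J t.
  by apply: nbhs_dnbhs; exact: open_nbhs_nbhs.
have n4 : \forall t \near (0 : R)^', edist (c t) v < r.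
  apply: nbhs_dnbhs; apply: (cc [set x | edist x v < r]).
  by apply/nbhs_edistP; exists r => //; rewrite c0.
have n5 : \forall t \near (0 : R)^', edist (t^-1 *: (c t - v)) (derive1 c 0) < e.
  have := dc [set x | edist x (derive1 c 0) < e].
  rewrite -/(derive c 0 1) -derive1E c0 => H.
  have {}H : \forall t \near (0 : R)^',
      edist (t^-1 *: ((c \o shift 0) (t *: 1) - v)) (derive1 c 0) < e.
    by apply: H; apply/nbhs_edistP; exists e.
  apply: filterS H => t; rewrite /= addr0.
  by rewrite [t *: 1]mulr1.
have [t [h1 [h2 [h3 [h4 h5]]]]] := filter_ex
  (filterI n1 (filterI n2 (filterI n3 (filterI n4 n5)))).
by exists t.
Qed.

(** Along a curve on [S] the difference quotient [q] satisfies [|N.q| <= C |t| |q|^2], which tends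
    to 0 while [q] tends to [w]. *)
Lemma tangent_vector_orthogonal (S : set 'rV[R]_3) v (N w : 'rV[R]_3) (r C : R) :
  0 < r -> 0 <= C ->
  (forall q, S q -> edist q v < r -> `|dotv N (q - v)| <= C * edist q v ^+ 2) ->
  tangent_vector S v w -> dotv N w = 0.
Proof.
move=> r0 C0 SN [J [c [[oJ J0] smc Sc c0 cw]]].
have dc : differentiable c 0 by exact: (smc 1%N).1.
have cc : {for 0, continuous c} by exact: differentiable_continuous.
apply/eqP; rewrite -normr_le0.
apply: (@le0_of_small _ _ (C * (enorm w + 1) ^+ 2 + enorm N) 1) => // e /andP[e0 e1].
have [t [t0 te Jt ctr]] := curve_near oJ J0 c0 (diff_derivable dc) cc e0 r0.
rewrite cw; set q := t^-1 *: _ => qw.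
have tq : c t - v = t *: q by rewrite /q scalerA mulfV// scale1r.
have := SN _ (Sc _ Jt) ctr; rewrite /Defs.edist tq dotvZr enormZ normrM.
rewrite exprMn mulrCA expr2 -mulrA ler_pM2l ?normr_gt0// => Nq.
have nq : enorm q <= enorm w + 1.
  rewrite -[q](subrK w) addrC; apply: le_trans (enorm_triangle _ _) _.
  by rewrite lerD2l; apply: le_trans (ltW e1); exact: ltW.
have nq2 : enorm q ^+ 2 <= (enorm w + 1) ^+ 2.
  by rewrite lerXn2r ?nnegrE ?addr_ge0 ?enorm_ge0.
have H1 : `|t| * (C * enorm q ^+ 2) <= e * (C * (enorm w + 1) ^+ 2).
  apply: ler_pM => //; [by rewrite mulr_ge0 ?sqr_ge0|exact: ltW|exact: ler_wpM2l].
have H2 : `|dotv N w| <= `|dotv N q| + enorm N * e.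
  have -> : dotv N w = dotv N q + dotv N (w - q) by rewrite -dotvDr subrKC.
  apply: le_trans (ler_normD _ _) _; rewrite lerD2l.
  apply: le_trans (normr_dotv_le _ _) _; rewrite ler_wpM2l ?enorm_ge0//.
  by rewrite -/(Defs.edist w q) edistC ltW.
rewrite mulrDr [e * enorm N]mulrC.
by apply: le_trans H2 _; rewrite lerD2r; apply: le_trans H1; rewrite mulrCA in Nq *.
Qed.

(** Two nearest points [p], [q] of [x] satisfy [2 (x - p).(q - p) = |q - p|^2], whereas the contact
    estimate bounds the left side by [2 C |x - p| |q - p|^2]. In [eta], the term [r / 2] keeps both
    feet within [r] of [v], and the other term gives [2 C eta < 1]. *)
Lemma medial_axis_away (S : set 'rV[R]_3) v (r C : R) : S v ->
  0 < r -> 0 <= C ->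
  (forall x p q, edist p v < r -> edist q v < r -> nearest S x p -> S q ->
    dotv (x - p) (q - p) <= C * edist x p * edist q p ^+ 2) ->
  exists2 eta, 0 < eta & forall m, medial_axis S m -> eta <= edist v m.
Proof.
move=> Sv r0 C0 quad.
pose eta := Num.min (r / 2) (1 / (2 * (C + 1))).
have C1 : 0 < 2 * (C + 1) by rewrite mulr_gt0// ltr_wpDl.
have eta0 : 0 < eta by rewrite lt_min !divr_gt0.
have etar : eta <= r / 2 by rewrite ge_min lexx.
have etaC : eta * (2 * (C + 1)) <= 1.
  by rewrite -ler_pdivlMr// ge_min lexx orbT.
exists eta => // m Mm; rewrite leNgt; apply/negP; rewrite edistC => mv.
have nm : nbhs m [set x | edist x v < eta].
  apply/nbhs_edistP; exists (eta - edist m v) => [|y]; first by rewrite subr_gt0.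
  by have := edist_triangle m y v => /= ? ?; lra.
have [x [[p [q [pq np nq]]] /= xv]] := Mm _ nm.
have xp : edist x p <= edist x v by exact: np.2.
have xq : edist x q <= edist x v by exact: nq.2.
have pv : edist p v < r.
  have := edist_triangle x p v; rewrite (edistC p x); lra.
have qv : edist q v < r.
  have := edist_triangle x q v; rewrite (edistC q x); lra.
have := quad x p q pv qv np nq.1.
have xpq : edist x p = edist x q.
  by apply/le_anti/andP; split; [exact: np.2 _ nq.1|exact: nq.2 _ np.1].
have : edist x q ^+ 2 = edist x p ^+ 2 - 2 * dotv (x - p) (q - p) + edist q p ^+ 2.
  have xqE : x - q = (x - p) + - (q - p) by rewrite opprB addrA subrK.
  by rewrite !edist_sqr xqE dotv_sqrD dotvNl !dotvNr opprK mulrN.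
have qp0 : 0 < edist q p ^+ 2.
  by rewrite exprn_gt0// lt_def edist_ge0 edist_eq0 andbT eq_sym; apply/eqP.
rewrite -xpq => E H.
have : C * edist x p * edist q p ^+ 2 <= C * eta * edist q p ^+ 2.
  by rewrite ler_pM2r// ler_wpM2l// ltW// (le_lt_trans xp).
have : 2 * C * eta * edist q p ^+ 2 < edist q p ^+ 2.
  rewrite gtr_pMl//; lra.
lra.
Qed.

Lemma nearest_near (S : set 'rV[R]_3) v (N : 'rV[R]_3) (r C : R) : S v ->
  0 < r -> 0 <= C -> N != 0 ->
  (forall q, S q -> edist q v < r -> dotv N (q - v) <= C * edist q v ^+ 2) ->
  exists2 t0, 0 < t0 & nearest S (v + t0 *: N) v.
Proof.
move=> Sv r0 C0 N0 SN; have n0 : 0 < enorm N by rewrite enorm_gt0.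
have C1 : 0 < 2 * (C + 1) by rewrite mulr_gt0// ltr_wpDl.
(* The first term serves the points within [r] of [v], through the quadratic contact; the second
   serves the remaining ones, by Cauchy-Schwarz alone. *)
pose t0 := Num.min (1 / (2 * (C + 1))) (r / (2 * enorm N)).
have t00 : 0 < t0 by rewrite lt_min !divr_gt0// mulr_gt0.
have t0C : t0 * (2 * (C + 1)) <= 1 by rewrite -ler_pdivlMr// ge_min lexx.
have t0r : t0 * (2 * enorm N) <= r.
  by rewrite -ler_pdivlMr ?mulr_gt0// ge_min lexx orbT.
exists t0 => //; apply/nearestP => // q Sq; rewrite dotvZr -edist_sqr dotvC.
have e0 := edist_ge0 q v; have e2 := sqr_ge0 (edist q v).
have [qr|rq] := ltP (edist q v) r.
  have : t0 * dotv N (q - v) <= t0 * (C * edist q v ^+ 2).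
    by rewrite ler_pM2l// SN.
  have : t0 * (2 * (C + 1)) * edist q v ^+ 2 <= 1 * edist q v ^+ 2.
    by rewrite ler_wpM2r.
  have : 0 <= t0 * edist q v ^+ 2 by rewrite mulr_ge0// ltW.
  lra.
have : t0 * dotv N (q - v) <= t0 * (enorm N * edist q v).
  by rewrite ler_pM2l// dotv_le.
have : t0 * (2 * enorm N) * edist q v <= edist q v * edist q v.
  by rewrite ler_wpM2r// (le_trans t0r).
rewrite expr2; lra.
Qed.

Lemma normal_lineP (S : set 'rV[R]_3) v (N q : 'rV[R]_3) : N != 0 ->
  (forall w, tangent_vector S v w <-> dotv N w = 0) ->
  normal_line S v q <-> exists t, q = v + t *: N.
Proof.
move=> N0 TN; have NN : dotv N N != 0 by rewrite dotv_eq0.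
split=> [nq|[t ->] x /TN xN]; last first.
  by rewrite addrAC subrr add0r dotvZl xN mulr0.
exists (dotv N (q - v) / dotv N N).
set k := _ / _; pose w := q - v - k *: N.
have Nw : dotv N w = 0.
  by rewrite /w dotvDr dotvNr dotvZr /k divfK// subrr.
have := nq (v + w); rewrite /tangent_plane /= addrAC subrr add0r TN => /(_ Nw) qw.
have w0 : w == 0.
  by rewrite -dotv_eq0 {1}/w dotvDl dotvNl dotvZl qw Nw mulr0 subr0.
by move: w0; rewrite /w -addrA -opprD subr_eq0 => /eqP.
Qed.

(* The positivity of [ebs] matters: [ebs] is the junk value 0 when no medial point
   lies on the normal line, which only happens if [S] stays in its tangent plane. *)
Lemma ebs_bound (S : set 'rV[R]_3) v : compact S -> smooth_surface S -> S v ->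
  exists N : 'rV[R]_3, [/\ N != 0,
    forall w, tangent_vector S v w <-> dotv N w = 0 &
    forall p, S p -> dotv N (p - v) != 0 -> 0 < ebs S v /\
      2 * ebs S v * `|dotv N (p - v)| <= enorm N * edist p v ^+ 2].
Proof.
move=> cS smS Sv; have [A [B [r [C [N0 [r0 C0] tanAB SN quad]]]]] := surface_chart smS Sv.
set N := cross A B in N0 SN *; exists N.
have NN : dotv N N != 0 by rewrite dotv_eq0.
have TN w : tangent_vector S v w <-> dotv N w = 0.
  split=> [|Nw]; first exact: tangent_vector_orthogonal r0 C0 SN.
  have := cross_decomp A B w; rewrite (dotvC w (cross A B)) -/N Nw scale0r add0r.
  move=> /(congr1 (fun z => (dotv N N)^-1 *: z)).
  by rewrite scalerA mulVf// scale1r scalerDr !scalerA => ->; exact: tanAB.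
split => // p Sp pN0.
have [eta eta0 Meta] := medial_axis_away Sv r0 C0 quad.
(* The normal that points to the side of [p]. *)
pose w := Num.sg (dotv N (p - v)) *: N.
have sg0 : Num.sg (dotv N (p - v)) != 0 by rewrite sgr_eq0.
have w0 : w != 0 by rewrite scaler_eq0 negb_or sg0.
have pw : dotv (p - v) w = `|dotv N (p - v)|.
  by rewrite dotvZr dotvC [RHS]normrEsg.
have wN : enorm w = enorm N by rewrite enormZ normr_sg pN0 mul1r.
have Sw q : S q -> edist q v < r -> dotv w (q - v) <= C * edist q v ^+ 2.
  move=> Sq qr; apply: le_trans (SN q Sq qr).
  apply: le_trans (ler_norm _) _.
  by rewrite dotvZl normrM normr_sg pN0 mul1r.
have [t0 t00 near0] := nearest_near Sv r0 C0 w0 Sw.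
have pw0 : 0 < dotv (p - v) w by rewrite pw normr_gt0.
have [t t_gt0 [Mt tp]] := medial_point_on_ray cS Sp w0 pw0 t00 near0.
pose D := [set Defs.edist v m | m in medial_axis S `&` normal_line S v].
(* This bound is used twice: the infimum of [D] is a genuine one, and it is positive. *)
have Deta : lbound D eta by move=> _ [m [Mm _] <-]; exact: Meta.
have Dt : D (t * enorm N).
  exists (v + t *: w).
    split => //; apply/(normal_lineP _ N0 TN); exists (t * Num.sg (dotv N (p - v))).
    by rewrite -scalerA.
  by rewrite edistC /Defs.edist addrAC subrr add0r enormZ gtr0_norm// wN.
have ebs_le : ebs S v <= t * enorm N.
  by apply: inf_lbound => //; exists eta.
split.
  apply: lt_le_trans eta0 _; apply: lb_le_inf => //.
  by exists (t * enorm N).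
move: tp; rewrite pw -edist_sqr => tp.
have n0 := enorm_ge0 N.
have : ebs S v * `|dotv N (p - v)| <= t * enorm N * `|dotv N (p - v)|.
  by rewrite ler_wpM2r.
have : enorm N * (2 * t * `|dotv N (p - v)|) <= enorm N * edist p v ^+ 2.
  by rewrite ler_wpM2l.
lra.
Qed.

End EmptyBall.

(** * Angles of flats in terms of direction and normal vectors *)

Section Angles.
Variable R : realType.

Lemma acos_le (x y : R) : 0 <= x -> x <= y -> y <= 1 -> acos y <= acos x.
Proof.
move=> x0 xy y1.
have hx : -1 <= x <= 1 by lra.
have hy : -1 <= y <= 1 by lra.
rewrite leNgt -ltr_cos ?in_itv /= ?acos_ge0 ?acos_lepi//.
by rewrite !acosK ?in_itv// -leNgt.
Qed.

(** An angle with cosine [c >= 0] lies in [0, pi/2], where a bound on its sine [sqrt (1 - c^2)]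
    bounds the angle. *)
Lemma acos_le_asin (c x : R) : 0 <= c <= 1 -> Num.sqrt (1 - c ^+ 2) <= x -> x <= 1 ->
  acos c <= asin x.
Proof.
move=> /andP[c0 c1] cx x1.
have hc : -1 <= c <= 1 by lra.
have x0 : 0 <= x by apply: le_trans cx; exact: sqrtr_ge0.
have hx : -1 <= x <= 1 by lra.
have acos2 : acos c <= pi / 2 by rewrite -acos0; exact: acos_le.
have pi0 : 0 <= pi / 2 :> R by rewrite divr_ge0 ?pi_ge0.
rewrite leNgt -ltr_sin ?in_itv /=.
- by rewrite asinK ?in_itv// sin_acos// -leNgt.
- by rewrite asin_geNpi2// asin_lepi2.
- by rewrite acos2 andbT; apply: le_trans (acos_ge0 hc); rewrite oppr_le0.
Qed.

(** The triple-angle formula at [pi / 3] reads [4 c^3 - 3 c + 1 = 0], that is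
    [(c + 1) (2 c - 1)^2 = 0], and [c > 0]. *)
Lemma cos_pi3 : cos (pi / 3) = 1 / 2 :> R.
Proof.
have p0 := pi_gt0 R.
have c0 : 0 < cos (pi / 3 : R) by apply: cos_gt0_pihalf; lra.
have : cos (pi / 3 + (pi / 3) *+ 2) = -1 :> R.
  by have -> : pi / 3 + (pi / 3) *+ 2 = pi :> R; [field|exact: cospi].
rewrite cosD cos_mulr2n sin_mulr2n.
have := sin2cos2 (pi / 3 : R).
move: (cos _) (sin _) c0 => c s c0 sc E.
have : (c + 1) * (2 * c - 1) ^+ 2 = 0.
  have -> : (c + 1) * (2 * c - 1) ^+ 2 =
    c * (c ^+ 2 *+ 2 - 1) - (1 - c ^+ 2) * c *+ 2 + 1 by ring.
  rewrite -sc -[RHS](subrr (-1)) -{2}E; ring.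
move/eqP; rewrite mulf_eq0 sqrf_eq0 => /orP[/eqP ?|/eqP ?]; lra.
Qed.

Definition cosang n (u w : 'rV[R]_n) : R := `|dotv u w| / (enorm u * enorm w).

Lemma cosangC n (u w : 'rV[R]_n) : cosang u w = cosang w u.
Proof. by rewrite /cosang dotvC [enorm u * _]mulrC. Qed.

Lemma cosang_ge0 n (u w : 'rV[R]_n) : 0 <= cosang u w.
Proof. by rewrite divr_ge0// mulr_ge0 ?enorm_ge0. Qed.

Lemma cosang_le1 n (u w : 'rV[R]_n) : cosang u w <= 1.
Proof.
have [->|u0] := eqVneq u 0; first by rewrite /cosang dot0v normr0 mul0r.
have [->|w0] := eqVneq w 0; first by rewrite /cosang dotv0 normr0 mul0r.
by rewrite ler_pdivrMr ?mulr_gt0 ?enorm_gt0// mul1r normr_dotv_le.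
Qed.

Lemma cosang_sqr n (u w : 'rV[R]_n) :
  cosang u w ^+ 2 = dotv u w ^+ 2 / (dotv u u * dotv w w).
Proof. by rewrite /cosang expr_div_n exprMn !enorm_sqr real_normK ?num_real. Qed.

Lemma cosangZl n k (u w : 'rV[R]_n) : k != 0 -> cosang (k *: u) w = cosang u w.
Proof.
move=> k0; rewrite /cosang dotvZl enormZ normrM -(mulrA `|k| (enorm u)).
rewrite -mulf_div divff ?mul1r//.
by rewrite normr_eq0.
Qed.

(** Cauchy-Schwarz for [w] and the projection of [u] to the hyperplane orthogonal to [N]; equality
    occurs at the projection, see [cosang_orth_proj]. *)
Lemma cosang_orth_le n (N u w : 'rV[R]_n) : N != 0 -> u != 0 -> w != 0 ->
  dotv N w = 0 -> cosang u w <= Num.sqrt (1 - cosang u N ^+ 2).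
Proof.
rewrite -!dotv_gt0 => N0 u0 w0 Nw.
rewrite -(@ler_pXn2r _ 2) ?nnegrE ?sqrtr_ge0 ?cosang_ge0//.
have c1 : 0 <= 1 - cosang u N ^+ 2 by rewrite subr_ge0 expr_le1 ?cosang_ge0 ?cosang_le1.
rewrite sqr_sqrtr// !cosang_sqr ler_pdivrMr ?mulr_gt0//.
have := CauchySchwarz_dotv (dotv N N *: u - dotv u N *: N) w.
rewrite !dotvE (dotvC N u) Nw => H.
have H2 : dotv N N ^+ 2 * dotv u w ^+ 2 <=
    dotv N N * (dotv N N * dotv u u - dotv u N ^+ 2) * dotv w w.
  by move: H; congr (_ <= _); ring.
rewrite -(@ler_pM2l _ (dotv N N ^+ 2)) ?exprn_gt0//; apply: le_trans H2 _.
rewrite le_eqVlt; apply/orP; left; apply/eqP; field.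
by rewrite !gt_eqF.
Qed.

Lemma cosang_orth_proj n (N u : 'rV[R]_n) : N != 0 -> u != 0 ->
  dotv N N *: u - dotv u N *: N != 0 ->
  cosang u (dotv N N *: u - dotv u N *: N) = Num.sqrt (1 - cosang u N ^+ 2).
Proof.
rewrite -!dotv_gt0; set w := _ - _ => N0 u0 w0.
have uw : dotv u w = dotv N N * dotv u u - dotv u N ^+ 2 by rewrite /w !dotvE; ring.
have ww : dotv w w = dotv N N * dotv u w.
  by rewrite uw /w !dotvE (dotvC N u); ring.
rewrite ww pmulr_rgt0// in w0.
apply/eqP; rewrite -(@eqrXn2 _ 2) ?sqrtr_ge0 ?cosang_ge0//.
have c1 : 0 <= 1 - cosang u N ^+ 2 by rewrite subr_ge0 expr_le1 ?cosang_ge0 ?cosang_le1.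
rewrite sqr_sqrtr// !cosang_sqr ww; apply/eqP.
have -> : dotv u w ^+ 2 / (dotv u u * (dotv N N * dotv u w)) =
  dotv u w / (dotv u u * dotv N N) by field; rewrite !gt_eqF.
by rewrite uw; field; rewrite !gt_eqF.
Qed.

Lemma inf_min (D : set R) x : D x -> lbound D x -> inf D = x.
Proof.
move=> Dx lx; apply/le_anti/andP; split; last by apply: lb_le_inf => //; exists x.
by apply: ge_inf => //; exists x.
Qed.

Lemma sup_max (D : set R) x : D x -> ubound D x -> sup D = x.
Proof.
move=> Dx lx; apply/le_anti/andP; split; first by apply: sup_le_ub => //; exists x.
by apply: sup_ubound => //; exists x.
Qed.

Lemma line_dir_line (F : set 'rV[R]_3) p N : N != 0 ->
  (forall x, F x <-> exists t, x = p + t *: N) ->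
  line_dir F = [set u | exists2 k, k != 0 & u = k *: N].
Proof.
move=> N0 FE; apply/seteqP; split=> [u [u0 [q Fq]]|u [k k0 ->]].
  have [s qs] := (FE _).1 (Fq 0); have [s' qs'] := (FE _).1 (Fq 1).
  have E : u = (s' - s) *: N.
    move: qs'; rewrite scale1r; move: qs; rewrite scale0r addr0 => ->.
    by rewrite -addrA => /addrI; rewrite scalerBl => <-; rewrite addrAC subrr add0r.
  exists (s' - s) => //; apply: contraNneq u0 => s0.
  by rewrite E s0 scale0r.
split; first by rewrite scaler_eq0 negb_or k0.
by exists p => t; apply/FE; exists (t * k); rewrite scalerA.
Qed.

Lemma line_dir_plane (F : set 'rV[R]_3) p N :
  (forall x, F x <-> dotv N (x - p) = 0) ->
  line_dir F = [set u | u != 0 /\ dotv N u = 0].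
Proof.
move=> FE; apply/seteqP; split=> u [u0].
  move=> [q Fq]; split=> //.
  have /FE := Fq 0; rewrite scale0r addr0 => q0.
  by have /FE := Fq 1; rewrite scale1r addrAC dotvDr q0 add0r.
move=> Nu; split=> //; exists p => t; apply/FE.
by rewrite addrAC subrr add0r dotvZr Nu mulr0.
Qed.

Lemma flat_angle_lines (F G : set 'rV[R]_3) p q M N : M != 0 -> N != 0 ->
  (forall x, F x <-> exists t, x = p + t *: M) ->
  (forall x, G x <-> exists t, x = q + t *: N) ->
  flat_angle F G = acos (cosang M N).
Proof.
move=> M0 N0 FE GE; rewrite /flat_angle (line_dir_line M0 FE) (line_dir_line N0 GE).
have ang k l : k != 0 -> l != 0 -> line_angle (k *: M) (l *: N) = acos (cosang M N).
  move=> k0 l0; rewrite /line_angle -/(cosang _ _) cosangZl//.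
  by rewrite cosangC cosangZl// cosangC.
have infE u : (exists2 k, k != 0 & u = k *: M) ->
    inf [set line_angle u w | w in [set u | exists2 k, k != 0 & u = k *: N]] =
    acos (cosang M N).
  move=> [k k0 ->]; apply: inf_min; last by move=> _ [_ [l l0 ->] <-]; rewrite ang.
  exists N; first by exists 1; rewrite ?scale1r ?oner_eq0.
  by rewrite -[N in line_angle _ N]scale1r ang ?oner_eq0.
apply: sup_max; last by move=> _ [u uM <-]; rewrite infE.
have MM : exists2 k, k != 0 & M = k *: M by exists 1; rewrite ?scale1r ?oner_eq0.
by exists M => //; exact: infE.
Qed.

(** For a direction [u] of [F] the inner minimum has cosine [co u], attained at the projection of
    [u] to [G]. The outer maximum minimizes [co u] and is attained at the projection of [N] to [F].
    Either projection may vanish and then needs another witness. *)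
Lemma flat_angle_planes (F G : set 'rV[R]_3) p q M N A : M != 0 -> N != 0 ->
  A != 0 -> dotv M A = 0 ->
  (forall x, F x <-> dotv M (x - p) = 0) ->
  (forall x, G x <-> dotv N (x - q) = 0) ->
  flat_angle F G = acos (cosang M N).
Proof.
move=> M0 N0 A0 MA FE GE; rewrite /flat_angle (line_dir_plane FE) (line_dir_plane GE).
pose co u := Num.sqrt (1 - cosang u N ^+ 2).
have co1 u : co u <= 1.
  by rewrite -[leRHS]sqrtr1 ler_wsqrtr// gerBl sqr_ge0.
have infE u : u != 0 /\ dotv M u = 0 ->
    inf [set line_angle u w | w in [set w | w != 0 /\ dotv N w = 0]] = acos (co u).
  move=> [u0 Mu]; apply: inf_min; last first.
    move=> _ [w [w0 Nw] <-]; rewrite /line_angle -/(cosang _ _).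
    by apply: acos_le => //; [exact: cosang_ge0|exact: cosang_orth_le].
  (* If [u] is parallel to [N], every direction of [G] is orthogonal to [u], and [M] is one of
     them. *)
  have [w0|w0] := eqVneq (dotv N N *: u - dotv u N *: N) 0; last first.
    exists (dotv N N *: u - dotv u N *: N).
      by split=> //; rewrite !dotvE (dotvC N u) mulrC subrr.
    by rewrite /line_angle -/(cosang _ _) cosang_orth_proj.
  have uN : u = (dotv u N / dotv N N) *: N.
    move/eqP: w0; rewrite subr_eq0 => /eqP E.
    by rewrite mulrC -scalerA -E scalerA mulVf ?scale1r// dotv_eq0.
  have k0 : dotv u N / dotv N N != 0.
    by apply: contraNneq u0 => k0; rewrite uN k0 scale0r.
  have NM : dotv N M = 0.
    move: Mu; rewrite uN dotvZr => /eqP; rewrite mulf_eq0 (negbTE k0) /= => /eqP.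
    by rewrite dotvC.
  exists M => //; rewrite /line_angle -/(cosang _ _) /co uN !cosangZl//.
  congr acos; rewrite /cosang NM normr0 mul0r -expr2 -enorm_sqr.
  by rewrite ger0_norm ?sqr_ge0// divff ?expf_neq0 ?enorm_eq0// expr1n subrr sqrtr0.
have c1 (x y : 'rV[R]_3) : 0 <= 1 - cosang x y ^+ 2.
  by rewrite subr_ge0 expr_le1 ?cosang_ge0 ?cosang_le1.
have coM u : u != 0 -> dotv M u = 0 -> cosang M N <= co u.
  move=> u0 Mu.
  have H := cosang_orth_le M0 N0 u0 Mu.
  rewrite -(@ler_pXn2r _ 2) ?nnegrE ?sqrtr_ge0 ?cosang_ge0//.
  have : cosang N u ^+ 2 <= 1 - cosang N M ^+ 2.
    by rewrite -[leRHS]sqr_sqrtr ?c1// lerXn2r ?nnegrE ?sqrtr_ge0 ?cosang_ge0.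
  rewrite sqr_sqrtr ?c1// (cosangC N u) (cosangC N M); lra.
apply: sup_max; last first.
  move=> _ [u uM <-]; rewrite infE//; case: uM => u0 Mu.
  by apply: acos_le (cosang_ge0 _ _) _ _; [exact: coM|exact: co1].
have attained u : u != 0 -> dotv M u = 0 -> co u = cosang M N ->
    [set inf [set line_angle u w | w in [set w | w != 0 /\ dotv N w = 0]] |
       u in [set u | u != 0 /\ dotv M u = 0]] (acos (cosang M N)).
  by move=> u0 Mu <-; exists u => //; exact: infE.
(* For parallel planes every direction of [F] gives angle 0, and [A] provides one. *)
have [w0|w0] := eqVneq (dotv M M *: N - dotv N M *: M) 0.
  apply: (attained A) => //; apply/le_anti; rewrite coM// andbT.
  suff -> : cosang M N = 1 by exact: co1.
  move/eqP: w0; rewrite subr_eq0 => /eqP E.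
  have k0 : dotv M M != 0 by rewrite dotv_eq0.
  rewrite cosangC -(cosangZl _ _ k0) E cosangZl; last first.
    by apply: contraNneq N0 => z; move: E; rewrite z scale0r => /eqP;
      rewrite scaler_eq0 (negbTE k0).
  by rewrite /cosang -enorm_sqr ger0_norm ?sqr_ge0// -expr2 divff// expf_neq0// enorm_eq0.
apply: (attained (dotv M M *: N - dotv N M *: M)) => //.
  by rewrite !dotvE (dotvC N M) mulrC subrr.
by rewrite /co cosangC cosang_orth_proj// sqr_sqrtr ?c1// subKr sqrtr_sqr
  ger0_norm ?cosang_ge0// cosangC.
Qed.

End Angles.

(** * Affine hull, equidistant line and circumradius of a triangle *)

Section Triangle.
Variable R : realType.
Implicit Types v a b x : 'rV[R]_3.

Lemma aff_triP v a b x : cross (a - v) (b - v) != 0 ->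
  aff_tri v a b x <-> dotv (cross (a - v) (b - v)) (x - v) = 0.
Proof.
set A := a - v; set B := b - v => M0; have MM : dotv (cross A B) (cross A B) != 0.
  by rewrite dotv_eq0.
have aE : a = v + A by rewrite subrKC.
have bE : b = v + B by rewrite subrKC.
split=> [[s [t [u [stu ->]]]]|Mx].
  have -> : s *: v + t *: a + u *: b - v = t *: A + u *: B.
    have -> : s = 1 - t - u by rewrite -stu; ring.
    by apply/rowP => i; rewrite !mxE; ring.
  exact: dotv_cross_comb.
have := cross_decomp A B (x - v); rewrite (dotvC (x - v) (cross A B)) Mx scale0r add0r.
move: (_ - _ * _) (_ - _ * _) => l k E.
have {}E : x - v = (k / dotv (cross A B) (cross A B)) *: A +
    (l / dotv (cross A B) (cross A B)) *: B.
  rewrite !(mulrC _ (_^-1)) -!scalerA -scalerDr -E.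
  by rewrite scalerA mulVf// scale1r.
move: E; set k' := k / _; set l' := l / _ => E.
exists (1 - k' - l'), k', l'; split; first by ring.
rewrite -[x](subrK v) E aE bE /A /B.
by apply/rowP => i; rewrite !mxE; ring.
Qed.

Lemma edist_eqE v a x : edist x v = edist x a <->
  2 * dotv (x - v) (a - v) = dotv (a - v) (a - v).
Proof.
have E : edist x a ^+ 2 = edist x v ^+ 2 +
    (dotv (a - v) (a - v) - 2 * dotv (x - v) (a - v)).
  have -> : edist x a = enorm ((x - v) + - (a - v)).
    by rewrite opprB addrA subrK.
  by rewrite enorm_sqr dotv_sqrD dotvNl !dotvNr opprK -edist_sqr; ring.
split=> [e|e]; first by rewrite e in E; lra.
apply/eqP; rewrite -(@eqrXn2 _ 2) ?edist_ge0// E e; apply/eqP; ring.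
Qed.

Lemma equidistantP v a b x : equidistant v a b x <->
  2 * dotv (x - v) (a - v) = dotv (a - v) (a - v) /\
  2 * dotv (x - v) (b - v) = dotv (b - v) (b - v).
Proof.
rewrite -!edist_eqE; split=> [[va ab]|[va vb]]; first by rewrite va.
by split=> //; rewrite -va.
Qed.

Lemma circumcenterP v a b : cross (a - v) (b - v) != 0 ->
  (aff_tri v a b `&` equidistant v a b) (circumcenter v a b).
Proof.
move=> M0; apply: xgetPex.
set A := a - v in M0 *; set B := b - v in M0 *.
have G0 : dotv A A * dotv B B - dotv A B ^+ 2 != 0 by rewrite -dotv_cross dotv_eq0.
set G := _ - _ in G0.
(* Cramer's rule for the two linear equations of [equidistantP]. *)
pose k := dotv B B * (dotv A A - dotv A B) / (2 * G).
pose l := dotv A A * (dotv B B - dotv A B) / (2 * G).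
exists (v + (k *: A + l *: B)); split.
  apply/(aff_triP _ M0); rewrite -/A -/B addrAC subrr add0r.
  exact: dotv_cross_comb.
have kl w : dotv (k *: A + l *: B) w = k * dotv A w + l * dotv B w.
  by rewrite dotvDl !dotvZl.
apply/equidistantP; rewrite -/A -/B addrAC subrr add0r !kl (dotvC B A).
by split; rewrite /k /l /G; field.
Qed.

Lemma equidistant_line v a b x : cross (a - v) (b - v) != 0 ->
  equidistant v a b x <->
  exists t, x = circumcenter v a b + t *: cross (a - v) (b - v).
Proof.
move=> M0; have [_ /equidistantP] := circumcenterP M0.
rewrite equidistantP; move: (circumcenter _ _ _) => O.
set A := a - v in M0 *; set B := b - v in M0 * => -[OA OB].
set M := cross A B in M0 *; have MM : dotv M M != 0 by rewrite dotv_eq0.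
split=> [[xA xB]|[t ->]]; last first.
  by rewrite addrAC !(dotvDl (O - v)) !dotvZl dotv_crossl dotv_crossr !mulr0 !addr0.
have A0 : dotv (x - O) A = 0.
  have -> : x - O = (x - v) - (O - v) by rewrite opprB addrA subrK.
  by rewrite dotvDl dotvNl; lra.
have B0 : dotv (x - O) B = 0.
  have -> : x - O = (x - v) - (O - v) by rewrite opprB addrA subrK.
  by rewrite dotvDl dotvNl; lra.
have := cross_decomp A B (x - O); rewrite A0 B0 !mulr0 subrr !scale0r !addr0 -/M => E.
exists (dotv (x - O) M / dotv M M); apply/eqP; rewrite addrC -subr_eq; apply/eqP.
by rewrite mulrC -scalerA -E scalerA mulVf// scale1r.
Qed.

(** The classical formula: product of the sides = 4 R area, squared. It follows from
    [cross_pythagoras] for the vector from [v] to the circumcenter, whose products with the sides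
    are half their squared lengths. *)
Lemma circumradius_sqr v a b : cross (a - v) (b - v) != 0 ->
  4 * dotv (cross (a - v) (b - v)) (cross (a - v) (b - v)) * circumradius v a b ^+ 2 =
  dotv (a - v) (a - v) * dotv (b - v) (b - v) *
  (dotv (a - v) (a - v) + dotv (b - v) (b - v) - 2 * dotv (a - v) (b - v)).
Proof.
move=> M0; rewrite /circumradius; have [/(aff_triP _ M0) OM /equidistantP] := circumcenterP M0.
move: (circumcenter _ _ _) OM => O OM [].
rewrite edist_sqr -mulrA cross_pythagoras (dotvC (O - v) (cross _ _)) OM.
move: (dotv (O - v) (a - v)) (dotv (O - v) (b - v)) => x y <- <-; ring.
Qed.

End Triangle.

(** * Half-angle cotangent and the largest angle *)

Section Bounds.
Variable R : realType.
Implicit Types v a b : 'rV[R]_3.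

Lemma ebs_ge0 (S : set 'rV[R]_3) v : 0 <= ebs S v.
Proof.
rewrite /ebs; set D := [set _ | _ in _].
have [->|/set0P D0] := eqVneq D set0; first by rewrite inf0.
by apply: lb_le_inf => // _ [m _ <-]; exact: edist_ge0.
Qed.

Lemma cot_half_acos (x : R) : -1 < x < 1 ->
  0 < cot (acos x / 2) /\ cot (acos x / 2) ^+ 2 = (1 + x) / (1 - x).
Proof.
move=> /andP[x1 x2]; have hx : -1 <= x <= 1 by lra.
have p0 := pi_gt0 R.
have a0 : 0 < acos x by apply: acos_gt0; lra.
have api : acos x < pi by apply: acos_ltpi; lra.
set h := acos x / 2.
have hE : acos x = h *+ 2 by rewrite /h; field.
have ch : 0 < cos h by apply: cos_gt0_pihalf; rewrite /h; lra.
have sh : 0 < sin h by apply: sin_gt0_pi; rewrite /h; lra.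
have c2 : x = cos h ^+ 2 *+ 2 - 1 by rewrite -cos_mulr2n -hE acosK ?in_itv.
split; first by rewrite divr_gt0.
have s2 := sin2cos2 h.
rewrite /cot expr_div_n s2 c2; field.
have sp : 0 < sin h ^+ 2 by rewrite exprn_gt0.
by apply/andP; split; rewrite gt_eqF//; lra.
Qed.

Lemma plane_angle_lt_pi3 v a b : a != v -> b != v -> plane_angle v a b < pi / 3 ->
  enorm (a - v) * enorm (b - v) < 2 * dotv (a - v) (b - v).
Proof.
rewrite -subr_eq0 -enorm_gt0 => a0; rewrite -subr_eq0 -enorm_gt0 => b0.
rewrite /plane_angle; set x := _ / _.
have x1 : `|x| <= 1.
  rewrite normrM normfV (ger0_norm (mulr_ge0 (enorm_ge0 _) (enorm_ge0 _))).
  exact: cosang_le1.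
have hx : -1 <= x <= 1 by rewrite -ler_norml.
have p0 := pi_gt0 R.
rewrite -ltr_cos ?in_itv /= ?acos_ge0 ?acos_lepi//; last by apply/andP; split; lra.
rewrite acosK ?in_itv// cos_pi3 /x ltr_pdivlMr ?mulr_gt0//; lra.
Qed.

(** Instead of the angle sum: if all three angles were below [pi / 3], the law of cosines would fail
    opposite the longest side [r], where [p^2 + q^2 - r^2 <= p q]. *)
Lemma plane_angle_max_ge v a b : a != v -> b != v -> a != b ->
  plane_angle a b v <= plane_angle v a b -> plane_angle b v a <= plane_angle v a b ->
  pi / 3 <= plane_angle v a b.
Proof.
move=> av bv ab ha hb; rewrite leNgt; apply/negP => hv.
have Hv := plane_angle_lt_pi3 av bv hv.
have Ha : enorm (b - a) * enorm (v - a) < 2 * dotv (b - a) (v - a).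
  by apply: plane_angle_lt_pi3 (le_lt_trans ha hv); rewrite eq_sym.
have Hb : enorm (v - b) * enorm (a - b) < 2 * dotv (v - b) (a - b).
  by apply: plane_angle_lt_pi3 (le_lt_trans hb hv); rewrite // eq_sym.
have law (p q r : 'rV[R]_3) :
    2 * dotv (q - p) (r - p) = enorm (q - p) ^+ 2 + enorm (r - p) ^+ 2 - enorm (q - r) ^+ 2.
  have -> : q - r = (q - p) + - (r - p) by rewrite opprB addrA subrK.
  by rewrite !enorm_sqr (dotv_sqrD (q - p)) dotvNl !(dotvNr (r - p)) opprK; ring.
have sym (p q : 'rV[R]_3) : enorm (p - q) = enorm (q - p) by rewrite -enormN opprB.
move: Hv Ha Hb; rewrite !law (sym b a) (sym v a) (sym v b).
have := enorm_ge0 (a - v); have := enorm_ge0 (b - v); have := enorm_ge0 (a - b).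
move: (enorm (a - v)) (enorm (b - v)) (enorm (a - b)) => x y z z0 y0 x0 h1 h2 h3.
have opp_max (p q r : R) : 0 <= p -> 0 <= q -> p <= r -> q <= r ->
    p ^+ 2 + q ^+ 2 - r ^+ 2 <= p * q.
  move=> p0 q0 pr qr.
  have p2 : p ^+ 2 <= r ^+ 2 by rewrite lerXn2r ?nnegrE// (le_trans p0).
  have q2 : q ^+ 2 <= r ^+ 2 by rewrite lerXn2r ?nnegrE// (le_trans q0).
  have [pq|/ltW qp] := leP p q.
    have : p * p <= p * q by rewrite ler_wpM2l.
    rewrite -expr2; lra.
  have : q * q <= p * q by rewrite ler_wpM2r.
  rewrite -expr2; lra.
have [xz|/ltW zx] := leP x z; have [yz|/ltW zy] := leP y z.
- by have := opp_max x y z x0 y0 xz yz; lra.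
- by have := opp_max z x y z0 x0 zy (le_trans xz zy); lra.
- by have := opp_max z y x z0 y0 zx (le_trans yz zx); lra.
have [xy|/ltW yx] := leP x y.
  by have := opp_max z x y z0 x0 zy xy; lra.
by have := opp_max z y x z0 y0 zx yx; lra.
Qed.

End Bounds.

(** * The sine estimate and the constants of the theorem *)

Section Main.
Variable R : realType.

Lemma sin_cosang_cross (A B N : 'rV[R]_3) : cross A B != 0 -> N != 0 ->
  1 - cosang (cross A B) N ^+ 2 =
  (dotv B B * dotv N A ^+ 2 - 2 * dotv A B * dotv N A * dotv N B
   + dotv A A * dotv N B ^+ 2) / (dotv (cross A B) (cross A B) * dotv N N).
Proof.
rewrite -!dotv_gt0 => M0 N0; rewrite cosang_sqr (dotvC (cross A B) N).
rewrite -[X in X - _](@divff _ (dotv (cross A B) (cross A B) * dotv N N)); last first.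
  by rewrite mulf_neq0 ?gt_eqF.
by rewrite -mulrBl {1}cross_pythagoras addrC addKr.
Qed.

Lemma sin_angle_bound (A B N : 'rV[R]_3) (e rad kap : R) :
  cross A B != 0 -> N != 0 -> 0 <= e -> 0 <= rad -> 1 <= kap ->
  (dotv N A != 0 -> 0 < e /\ 2 * e * `|dotv N A| <= enorm N * enorm A ^+ 2) ->
  (dotv N B != 0 -> 0 < e /\ 2 * e * `|dotv N B| <= enorm N * enorm B ^+ 2) ->
  4 * dotv (cross A B) (cross A B) * rad ^+ 2 =
    dotv A A * dotv B B * (dotv A A + dotv B B - 2 * dotv A B) ->
  dotv A A + dotv B B + 2 * dotv A B <=
    kap ^+ 2 * (dotv A A + dotv B B - 2 * dotv A B) ->
  Num.sqrt (1 - cosang (cross A B) N ^+ 2) <= rad / e * kap.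
Proof.
move=> M0 N0 e0 rad0 kap1 NA NB radE kapE.
have kap0 : 0 <= kap by rewrite (le_trans ler01).
have rhs0 : 0 <= rad / e * kap by rewrite !mulr_ge0 ?invr_ge0.
(* If [e = 0], the hypotheses make [N] orthogonal to [A] and [B], so the sine is 0, whatever the
   value of a division by zero. *)
have [eA|eA] := eqVneq e 0.
  have zero C : (dotv N C != 0 -> 0 < e /\ 2 * e * `|dotv N C| <= enorm N * enorm C ^+ 2) ->
      dotv N C = 0.
    by move=> H; apply/eqP; apply: contraT => /H[]; rewrite eA ltxx.
  rewrite sin_cosang_cross// (zero _ NA) (zero _ NB) !mulr0 expr0n !mulr0 subr0 addr0.
  by rewrite mul0r sqrtr0.
have {}e0 : 0 < e by rewrite lt_def eA.
have bound C : (dotv N C != 0 -> 0 < e /\ 2 * e * `|dotv N C| <= enorm N * enorm C ^+ 2) ->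
    2 * e * `|dotv N C| <= enorm N * dotv C C.
  move=> H; rewrite -enorm_sqr; have [->|/H[]//] := eqVneq (dotv N C) 0.
  by rewrite normr0 mulr0 mulr_ge0 ?enorm_ge0 ?sqr_ge0.
have {NA}NA := bound _ NA; have {NB}NB := bound _ NB.
have G0 : 0 < dotv (cross A B) (cross A B) by rewrite dotv_gt0.
have n0 : 0 < enorm N by rewrite enorm_gt0.
rewrite -[leRHS](ger0_norm rhs0) -sqrtr_sqr; apply: ler_wsqrtr.
rewrite sin_cosang_cross// -(enorm_sqr N).
have p0 := dotv_ge0 A; have q0 := dotv_ge0 B.
have pq0 : 0 <= dotv A A * dotv B B by rewrite mulr_ge0.
have E : (rad / e * kap) ^+ 2 = kap ^+ 2 * rad ^+ 2 / e ^+ 2 by rewrite !exprMn exprVn; ring.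
rewrite E ler_pdivrMr ?mulr_gt0 ?exprn_gt0//.
have e2 : 0 < 4 * e ^+ 2 by rewrite mulr_gt0// exprn_gt0.
rewrite -(ler_pM2l e2).
have -> : 4 * e ^+ 2 * (kap ^+ 2 * rad ^+ 2 / e ^+ 2 *
    (dotv (cross A B) (cross A B) * enorm N ^+ 2)) =
    enorm N ^+ 2 * kap ^+ 2 * (4 * dotv (cross A B) (cross A B) * rad ^+ 2).
  by field; rewrite gt_eqF.
rewrite radE.
move: (dotv A A) (dotv B B) (dotv A B) (dotv N A) (dotv N B) (enorm N)
  p0 q0 pq0 NA NB n0 kapE {radE} => p q r x y n p0 q0 pq0 xn yn n0 kapE.
have H1 : 4 * e ^+ 2 * x ^+ 2 <= n ^+ 2 * p ^+ 2.
  rewrite -[x ^+ 2]real_normK ?num_real//.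
  have -> : 4 * e ^+ 2 * `|x| ^+ 2 = (2 * e * `|x|) ^+ 2 by ring.
  by rewrite -exprMn lerXn2r ?nnegrE ?mulr_ge0// ltW.
have H2 : 4 * e ^+ 2 * y ^+ 2 <= n ^+ 2 * q ^+ 2.
  rewrite -[y ^+ 2]real_normK ?num_real//.
  have -> : 4 * e ^+ 2 * `|y| ^+ 2 = (2 * e * `|y|) ^+ 2 by ring.
  by rewrite -exprMn lerXn2r ?nnegrE ?mulr_ge0// ltW.
have H3 : 4 * e ^+ 2 * `|x * y| <= n ^+ 2 * (p * q).
  have -> : 4 * e ^+ 2 * `|x * y| = (2 * e * `|x|) * (2 * e * `|y|).
    by rewrite normrM; ring.
  have -> : n ^+ 2 * (p * q) = (n * p) * (n * q) by ring.
  by rewrite ler_pM ?mulr_ge0// ltW.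
have kap2 : 1 <= kap ^+ 2 by rewrite expr_ge1.
(* For [r < 0] the two sides differ only by the factor [kap ^+ 2 >= 1]; this is the role of the 1 in
   the maximum. *)
have H4 : p + q + 2 * `|r| <= kap ^+ 2 * (p + q - 2 * r).
  have [r0|r0] := leP 0 r; first by rewrite ger0_norm.
  rewrite ltr0_norm// mulrN.
  have : 0 <= (kap ^+ 2 - 1) * (p + q - 2 * r).
    by rewrite mulr_ge0 ?subr_ge0//; lra.
  lra.
have H5 : 4 * e ^+ 2 * - (2 * r * x * y) <= 2 * `|r| * (n ^+ 2 * (p * q)).
  apply: (@le_trans _ _ (2 * `|r| * (4 * e ^+ 2 * `|x * y|))).
    have := ler_norm (- (r * (x * y))); rewrite normrN normrM => h.
    have -> : 4 * e ^+ 2 * - (2 * r * x * y) = (4 * e ^+ 2 * 2) * - (r * (x * y)) by ring.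
    have -> : 2 * `|r| * (4 * e ^+ 2 * `|x * y|) = (4 * e ^+ 2 * 2) * (`|r| * `|x * y|).
      by ring.
    by rewrite ler_wpM2l// mulr_ge0// ltW.
  by rewrite ler_wpM2l// mulr_ge0.
have H6 : q * (4 * e ^+ 2 * x ^+ 2) <= q * (n ^+ 2 * p ^+ 2) by rewrite ler_wpM2l.
have H7 : p * (4 * e ^+ 2 * y ^+ 2) <= p * (n ^+ 2 * q ^+ 2) by rewrite ler_wpM2l.
have H8 : n ^+ 2 * (p * q) * (p + q + 2 * `|r|) <=
    n ^+ 2 * (p * q) * (kap ^+ 2 * (p + q - 2 * r)).
  by rewrite ler_wpM2l// mulr_ge0// sqr_ge0.
lra.
Qed.

Lemma cos_angle_lt1 (A B : 'rV[R]_3) : cross A B != 0 ->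
  -1 < dotv A B / (enorm A * enorm B) < 1.
Proof.
move=> AB0; have [A0 B0] := cross_neq0 AB0.
have nAB : 0 < enorm A * enorm B by rewrite mulr_gt0 ?enorm_gt0.
move: AB0; rewrite -dotv_gt0 dotv_cross subr_gt0 => H; rewrite -ltr_norml.
rewrite normrM normfV (gtr0_norm nAB) ltr_pdivrMr// mul1r.
rewrite -(@ltr_pXn2r _ 2) ?nnegrE ?(ltW nAB)//.
by rewrite exprMn !enorm_sqr real_normK ?num_real.
Qed.

(** With side lengths [p], [q] and [x > 0], the ratio of [p^2 + q^2 + 2 x p q] to
    [p^2 + q^2 - 2 x p q] is largest at [p = q], where it is the squared cotangent of the half
    angle; for [x <= 0] it is at most 1. *)
Lemma max_cot_half_bound (A B : 'rV[R]_3) (x : R) : cross A B != 0 ->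
  x = dotv A B / (enorm A * enorm B) ->
  dotv A A + dotv B B + 2 * dotv A B <=
    Num.max (cot (acos x / 2)) 1 ^+ 2 * (dotv A A + dotv B B - 2 * dotv A B).
Proof.
move=> AB0 xE; have := cos_angle_lt1 AB0; rewrite -xE => hx.
have [c0 c2] := cot_half_acos hx; case/andP: hx => x1 x2.
have nAB : 0 < enorm A * enorm B.
  by have [A0 B0] := cross_neq0 AB0; rewrite mulr_gt0 ?enorm_gt0.
have rE : dotv A B = x * (enorm A * enorm B) by rewrite xE divfK// gt_eqF.
rewrite rE -!enorm_sqr.
have := enorm_ge0 A; have := enorm_ge0 B.
move: (enorm A) (enorm B) nAB => p q pq q0 p0.
have amgm : 0 <= (p - q) ^+ 2 by exact: sqr_ge0.
have diff0 : 0 <= p ^+ 2 + q ^+ 2 - 2 * (x * (p * q)) by nra.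
set k := Num.max _ _.
have k1 : 1 <= k by rewrite le_max lexx orbT.
have kc : cot (acos x / 2) <= k by rewrite le_max lexx.
have [x0|x0] := leP x 0.
  have : 1 <= k ^+ 2 by rewrite expr_ge1// (le_trans ler01).
  have : x * (p * q) <= 0 by rewrite mulr_le0_ge0// ltW.
  nra.
have : (1 + x) / (1 - x) <= k ^+ 2.
  by rewrite -c2 lerXn2r ?nnegrE ?(ltW c0)// (le_trans (ltW c0)).
move=> /(ler_wpM2r diff0); apply: le_trans.
rewrite mulrAC ler_pdivlMr; last lra.
nra.
Qed.

Lemma max_cot_half_le_sqrt3 (x : R) : -1 < x < 1 -> pi / 3 <= acos x ->
  Num.max (cot (acos x / 2)) 1 <= Num.sqrt 3.
Proof.
move=> hx ax; have [c0 c2] := cot_half_acos hx; case/andP: hx => x1 x2.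
have x12 : x <= 1 / 2.
  rewrite leNgt; apply/negP => x12; move: ax; apply/negP; rewrite -ltNge.
  have hx' : -1 <= x <= 1 by lra.
  have p0 := pi_gt0 R.
  rewrite -ltr_cos ?in_itv /= ?acos_ge0 ?acos_lepi//; last by apply/andP; split; lra.
  by rewrite acosK ?in_itv// cos_pi3.
rewrite ge_max; apply/andP; split; last by rewrite -[leLHS]sqrtr1 ler_wsqrtr// ler1n.
rewrite -[leLHS](ger0_norm (ltW c0)) -sqrtr_sqr ler_wsqrtr// c2.
rewrite ler_pdivrMr; lra.
Qed.

End Main.

Theorem lemma2 (R : realType) (S : set 'rV[R]_3)
    (S_compact : compact S) (S_surface : smooth_surface S)
    (v a b : 'rV[R]_3) (Sv : S v) (Sa : S a) (Sb : S b)
    (tau_triangle : triangle v a b) :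
  let rad := circumradius v a b in
  let phi := plane_angle v a b in
  let angN := flat_angle (equidistant v a b) (normal_line S v) in
  let angT := flat_angle (aff_tri v a b) (tangent_plane S v) in
  [/\ angN = angT,
      rad / ebs S v * Num.max (cot (phi / 2)) 1 <= 1 ->
        angN <= asin (rad / ebs S v * Num.max (cot (phi / 2)) 1) &
      plane_angle a b v <= phi -> plane_angle b v a <= phi ->
        pi / 3 <= phi /\
        (rad < ebs S v / Num.sqrt 3 ->
          angN <= asin (Num.sqrt 3 * rad / ebs S v))].
Proof.
move=> rad phi angN angT.
have M0 := free_cross_neq0 tau_triangle.
have [N [N0 TN Nebs]] := ebs_bound S_compact S_surface Sv.
set M := cross (a - v) (b - v) in M0.
have [A0 B0] := cross_neq0 M0.
have ab : a != b.
  apply: contraNneq M0 => ab.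
  by rewrite /M ab -dotv_eq0 dotv_cross -expr2 subrr.
(* [M] directs the equidistant line and is normal to the triangle, as [N] directs the normal line
   and is normal to the tangent plane; so both angles become the same [acos]. *)
have angNE : angN = acos (cosang M N).
  apply: (flat_angle_lines (p := circumcenter v a b) (q := v)) => // x.
    exact: equidistant_line.
  exact: normal_lineP.
have angTE : angT = acos (cosang M N).
  apply: (flat_angle_planes (p := v) (q := v) (A := a - v)) => //.
  - exact: dotv_crossl.
  - by move=> x; exact: aff_triP.
  - by move=> x; rewrite /tangent_plane /= TN.
have e0 := ebs_ge0 S v.
have rad0 : 0 <= rad by exact: edist_ge0.
have c01 : 0 <= cosang M N <= 1 by rewrite cosang_ge0 cosang_le1.
have cosphi := cos_angle_lt1 M0.
set x := _ / _ in cosphi.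
have phiE : phi = acos x by [].
have sinN : Num.sqrt (1 - cosang M N ^+ 2) <=
    rad / ebs S v * Num.max (cot (phi / 2)) 1.
  apply: sin_angle_bound => //.
  - by rewrite le_max lexx orbT.
  - exact: Nebs.
  - exact: Nebs.
  - exact: circumradius_sqr.
  - exact: max_cot_half_bound.
split; first by rewrite angNE angTE.
- by move=> arg1; rewrite angNE; exact: acos_le_asin.
move=> ha hb.
have phi3 : pi / 3 <= phi.
  by apply: plane_angle_max_ge => //; rewrite -subr_eq0.
split=> // radlt; rewrite angNE.
have s3 : 0 < Num.sqrt 3 :> R by rewrite sqrtr_gt0.
(* [rad] is nonnegative, so the strict inequality excludes the value 0 of [ebs]. *)
have e_gt0 : 0 < ebs S v.
  rewrite lt_def e0 andbT; apply: contraTneq radlt => ->.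
  by rewrite mul0r -leNgt.
apply: acos_le_asin => //.
  apply: le_trans sinN _; rewrite -[leRHS]mulrA [leRHS]mulrC.
  rewrite ler_wpM2l ?divr_ge0//; exact: max_cot_half_le_sqrt3.
by rewrite ler_pdivrMr// mul1r mulrC -ler_pdivlMr// ltW.
Qed.
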